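(* Assume $\nu(E)<\infty$ and let $N$ be a Cox process on $[0,T]\times E$, $T<\infty$, with stochastic intensity $\{\lambda_{(t,x)}\}_{(t,x)\in[0,T]\times E}$ satisfying $$\alpha(t,x)\le\lambda_{(t,x)}\le\beta(t,x),\quad\mathrm dt\,\nu(\mathrm dx)\,\mathbb P(\mathrm d\omega)\text{-almost everywhere},$$ for some non-negative functions $\alpha,\beta$ with $\beta\in L^1([0,T]\times E,\mathrm dt\,\nu(\mathrm dx))$ and $\beta^3\alpha^{-2}\in L^1([0,T]\times E,\mathrm dt\,\nu(\mathrm dx))$. Let $$G:=\int_{[0,T]\times E}g(s,y)\,N(\mathrm ds\times\mathrm dy),\quad g\in L^2([0,T]\times E,\beta(t,x)\,\mathrm dt\,\nu(\mathrm dx)).$$ Let $g_1\in L^2([0,T]\times E,\beta(t,x)\,\mathrm dt\,\nu(\mathrm dx))$ be such that $|g(t,x)|\le g_1(t,x)$, $(t,x)\in[0,T]\times E$, and let $g_2\in L^2([0,T]\times E,\beta(t,x)\,\mathrm dt\,\nu(\mathrm dx))$ be such that, for $(t,x)\in[0,T]\times E$, $$\sqrt2\biggl[\int_{[t,T]\times E}g(s,y)^2\beta(s,y)\,\mathrm ds\,\nu(\mathrm dy)+\biggl(\int_{[t,T]\times E}|g(s,y)|\beta(s,y)\,\mathrm ds\,\nu(\mathrm dy)\biggr)^2\biggr]^{1/2}\sqrt{\frac{\beta(t,x)^2}{\alpha(t,x)^2}-1}\le g_2(t,x).$$ Set $h:=g_1+g_2$. Then, with $d(x,y):=|x-y|$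 on $\mathbb R$, $$c(\mathcal T_d(\sigma,\mathcal L(G)))\le H(\sigma\mid\mathcal L(G))\quad\text{for any }\sigma\in M_1(\mathbb R,d),$$ where $\mathcal L(G)$ is the law of $G$, $c:=\Lambda^{\odot}$ and $$\Lambda(\theta):=\int_{[0,T]\times E}\bigl(\mathrm e^{\theta h(t,x)}-\theta h(t,x)-1\bigr)\beta(t,x)\,\mathrm dt\,\nu(\mathrm dx),\quad\theta\in\mathbb R_+.$$ Moreover, for any $M>0$ such that $\|g_1+g_2\|_\infty\le M$, $$c(x)\ge\frac{x+M^{-1}V}{M}\ln\Bigl(1+\frac{x}{M^{-1}V}\Bigr)-\frac xM,\quad x\in\mathbb R_+,\qquad V:=\int_{[0,T]\times E}h(t,z)^2\beta(t,z)\,\mathrm dt\,\nu(\mathrm dz).$$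
   Context: $E$ is a complete separable metric space with its Borel $\sigma$-field and $\nu$ a locally finite measure on it. A Cox process on $[0,T]\times E$ with (random, non-negative, measurable) intensity $\lambda$ is a point process which, conditionally on $\lambda$, is Poisson with intensity $\lambda_{(t,x)}$ with respect to $\mathrm dt\,\nu(\mathrm dx)$. Convention: $0/0:=0$. For the metric $d$ on $\mathbb R$, $\mathcal T_d(\sigma_1,\sigma_2):=\inf_\rho\int d(x,y)\,\rho(\mathrm dx\times\mathrm dy)$, the infimum being over probability measures $\rho$ on $\mathbb R\times\mathbb R$ with first marginal $\sigma_1$ and second marginal $\sigma_2$. $M_1(\mathbb R,d)$ is the set of Borel probability measures $\sigma$ on $\mathbb R$ with $\int d(x_0,x)\,\sigma(\mathrm dx)<\infty$ for some $x_0$. $H(\sigma_1\mid\sigma_2):=\int\log(\mathrm d\sigma_1/\mathrm d\sigma_2)\,\mathrm d\sigma_1$ if $\sigma_1\ll\sigma_2$ and $+\infty$ otherwise. The monotone conjugate of a measurable $k:\mathbb R_+\to[0,\infty]$ is $k^{\odot}(x):=\sup_{\theta\ge0}(\theta x-k(\theta))$, $x\in\mathbb R_+$. *)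

(* Defs.v *)
From HB Require Import structures.
From mathcomp Require Import all_boot all_order all_algebra.
From mathcomp Require Import all_classical all_reals all_analysis.

Set Implicit Arguments.
Unset Strict Implicit.
Unset Printing Implicit Defensive.

Import Order.TTheory GRing.Theory Num.Theory.
Import numFieldNormedType.Exports.

Local Open Scope classical_set_scope.
Local Open Scope ring_scope.
Local Open Scope ereal_scope.

(* Quotients below are taken in [\bar R], where [0^-1 = +oo] and [0 * +oo = 0]:
   hence [0 / 0 = 0], while [a / 0 = +oo] for [0 < a]. *)

#[short(type="completeMetricType")]
HB.structure Definition CompleteMetric (R : numDomainType) :=
  {T of CompletePseudoMetric R T & PseudoMetric_isMetric R T}.

Definition separable (T : topologicalType) : Prop :=
  exists2 S : set T, countable S & dense S.

Notation borelType E := (g_sigma_algebraType (@open E)).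

(* Processes on [0, T] x E live on the carrier R x E and are only looked at on
   the slab [0, T] x E. *)
Notation timeSpace R E := (measurableTypeR R * borelType E)%type.

Definition slab {R : realType} {E : completeMetricType R} (a b : R) :
  set (timeSpace R E) := `[a, b] `*` [set: E].

Section weighted_spaces.
Context {d : measure_display} {Z : measurableType d} {R : realType}.
Variables (mu : {measure set Z -> \bar R}) (D : set Z) (w : Z -> R).

(* f belongs to L^2(D, w dmu) *)
Definition weighted_L2 (f : Z -> R) : Prop :=
  measurable_fun D f /\ mu.-integrable D (fun z => ((f z) ^+ 2 * w z)%:E).

(* Essential supremum of |f| over D with respect to w dmu: for nonnegative w,
   a subset of D is w dmu-null iff its trace on {w > 0} is mu-null. *)
Definition weighted_Linfty_norm (f : Z -> R) : \bar R :=
  'N[mu]_+oo [EFin \o (f \_ (D `&` [set z | (0 < w z)%R]))].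

End weighted_spaces.

Section point_processes.
Context {d : measure_display} {Omega : measurableType d} {R : realType}.

(* A kernel from Omega is a random measure. *)
Definition point_process {E : completeMetricType R} (T : R)
    (N : R.-ker Omega ~> timeSpace R E) : Prop :=
  [/\ forall omega, N omega (~` slab 0 T) = 0,
      forall omega A, measurable A ->
        N omega A = +oo \/ exists k : nat, N omega A = k%:R%:E &
      forall omega t (x : E), exists2 e : R, (0 < e)%R &
        N omega (ball t e `*` ball x e) < +oo].

(* The mass at k of the Poisson law with mean m in [0, +oo]; the law with
   infinite mean is the Dirac mass at +oo. The first nat argument of the
   library's [poisson_prob] is a dummy. *)
Definition poisson_mass (m : \bar R) (k : nat) : \bar R :=
  if m is r%:E then poisson_prob r k [set k] else 0.

(* sigma(lambda_z : z in D) *)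
Definition intensity_sigma_algebra {Z : Type} (D : set Z)
    (lambda : Z -> Omega -> R) : set (set Omega) :=
  <<s \bigcup_(z in D) preimage_set_system setT (lambda z) measurable >>.

(* For pairwise disjoint A_1, ..., A_n, the product of Poisson masses is the
   conditional probability of {N(A_1) = k_1, ..., N(A_n) = k_n} given
   sigma(lambda), expressed by its integrals over the events B of
   sigma(lambda). *)
Definition conditionally_poisson (P : probability Omega R)
    {d' : measure_display} {Z : measurableType d'}
    (mu : {measure set Z -> \bar R}) (D : set Z)
    (lambda : Z -> Omega -> R) (N : R.-ker Omega ~> Z) : Prop :=
  forall (n : nat) (A : 'I_n -> set Z) (k : 'I_n -> nat) (B : set Omega),
    (forall i, measurable (A i)) -> (forall i, A i `<=` D) ->
    trivIset setT A -> intensity_sigma_algebra D lambda B ->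
    P (B `&` [set omega | forall i, N omega (A i) = (k i)%:R%:E]) =
    \int[P]_(omega in B)
      \prod_(i < n)
         poisson_mass (\int[mu]_(z in A i) (lambda z omega)%:E) (k i).

Definition cox_process (P : probability Omega R) {E : completeMetricType R}
    (nu : {finite_measure set (borelType E) -> \bar R}) (T : R)
    (lambda : timeSpace R E -> Omega -> R)
    (N : R.-ker Omega ~> timeSpace R E) : Prop :=
  [/\ measurable_fun (slab 0 T `*` [set: Omega])
        (fun p : timeSpace R E * Omega => lambda p.1 p.2),
      forall z omega, slab 0 T z -> (0 <= lambda z omega)%R,
      point_process T N &
      conditionally_poisson P (lebesgue_measure \x nu) (slab 0 T) lambda N].

End point_processes.

Section transport_entropy.
Context {R : realType}.
Implicit Types (s : probability R R) (dist : R -> R -> R).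

Definition coupling s1 s2 : set (probability (R * R)%type R) :=
  [set rho | forall A : set R, measurable A ->
     rho (A `*` setT) = s1 A /\ rho (setT `*` A) = s2 A].

Definition transport_cost dist s1 s2 : \bar R :=
  ereal_inf [set \int[rho]_z (dist z.1 z.2)%:E | rho in coupling s1 s2].

Definition finite_first_moment dist s : Prop :=
  exists x0 : R, \int[s]_x (dist x0 x)%:E < +oo.

Definition relative_entropy s1 s2 : \bar R :=
  if `[< s1 `<< s2 >] then
    \int[s1]_x lne (Radon_Nikodym (charge_of_finite_measure s1) s2 x)
  else +oo.

(* Defined at every x in [0, +oo], as a transport cost is a priori an extended
   real. *)
Definition monotone_conjugate (k : R -> \bar R) (x : \bar R) : \bar R :=
  ereal_sup [set theta%:E * x - k theta | theta in [set theta | (0 <= theta)%R]].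

End transport_entropy.

(* Main.v *)
Require Import Defs.
From HB Require Import structures.
From mathcomp Require Import all_boot all_order all_algebra.
From mathcomp Require Import all_classical all_reals all_analysis.
From mathcomp Require Import measurable_realfun ess_sup_inf zify ring lra.

Set Implicit Arguments.
Unset Strict Implicit.
Unset Printing Implicit Defensive.

Import Order.TTheory GRing.Theory Num.Theory.
Import numFieldNormedType.Exports.

Local Open Scope classical_set_scope.
Local Open Scope ring_scope.
Local Open Scope ereal_scope.

(** Write phi x = e^x - x - 1, so that Lambda th is the integral of phi (th h) with
    respect to beta dt nu.

    By duality the transport-entropy inequality is a statement about Laplace
    transforms. If E e^(th (f(G) - E f(G))) <= e^(Lambda th) for all th >= 0 and all
    bounded 1-Lipschitz f, then th * cost - Lambda th is at most the entropy for
    every th, and the supremum over th is the claim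
    ([transport_entropy_of_laplace]). On the line this implication is elementary.
    The coupling by quantile functions q1, q2 costs the integral of |q1 - q2|, and
    the function whose slope is 1 where one distribution function is the smaller
    and -1 elsewhere is 1-Lipschitz and turns this cost into a difference of means
    ([transport_cost_le_potential]). The Gibbs variational inequality ([gibbs])
    bounds differences of means by the entropy.

    For the Laplace transform of G ([laplace_transform_le]) the randomness of the
    points and that of the intensity are treated separately. Given the intensity,
    G is a Poisson integral in which a point at z moves f(G) by at most |g z|. This
    bounds the conditional Laplace transform by the exponential of th U plus the
    integral of phi (th |g|) lambda, where U is the conditional mean of f(G). As a
    function of the intensity, U changes by at most the integral of
    |g| |lambda - lambda'| when lambda becomes lambda'. A variable whose
    oscillation is at most l satisfies E e^(U - E U) <= e^(l^2)
    ([exp_moment_oscillation]), which leaves the square of that integral to be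
    bounded. Writing it over pairs of points and ordering their times
    ([sqr_integral_le_ordered]), it is at most twice the integral of
    |g| (beta - alpha) against the tail integral of |g| beta, and the lower bound
    imposed on g2 makes this at most the integral of g1 g2 beta ([g2_tail]). Finally
    phi (x + y) >= phi x + x y ([phi_add]): adding g2 to g1 in Lambda pays for
    exactly this cross term.

    The conditional estimates for Poisson integrals are proved for finite sums of
    weighted counts of disjoint sets, whose law is determined by the definition of
    a Cox process. A Poisson average is a limit of binomial averages, that is, of
    iterated Bernoulli steps, and for one step the estimates are explicit. Simple
    approximations of g and dominated convergence give the general case
    ([laplace_cox]).

    For the explicit lower bound on the conjugate, h <= M implies
    phi (th h) <= (h / M)^2 phi (th M), hence Lambda th <= V / M^2 phi (th M), whose
    conjugate is computed at th = ln (1 + M x / V) / M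
    ([monotone_conjugate_bennett]). *)

(** * Bernoulli walks *)

Section elementary.
Local Open Scope ring_scope.
Context {R : realType}.
Implicit Types (p a x y t : R) (u v : nat -> R).

(** The log-Laplace transform of a centred Poisson variable of mean 1. *)
Definition phi x : R := expR x - x - 1.

Lemma phi_ge0 x : 0 <= phi x.
Proof. by rewrite /phi; have := @expR_ge1Dx R x; lra. Qed.

(** In the series of phi only powers k >= 2 occur, and t^k <= t^2 for these. *)
Lemma phi_scale t x : `|t| <= 1 -> 0 <= x -> phi (t * x) <= t ^+ 2 * phi x.
Proof.
move=> t1 x0.
have phiE y : (series (exp_coeff y) n.+2 - y - 1) @[n --> \oo] --> phi y.
  rewrite /phi; apply: cvgB; last exact: cvg_cst.
  apply: cvgB; last exact: cvg_cst.
  have := @is_cvg_series_exp_coeff R y.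
  by rewrite -(cvg_shiftn 2); under eq_fun do rewrite addn2.
have step n y : series (exp_coeff y) n.+2 - y - 1 =
    \sum_(2 <= k < n.+2) exp_coeff y k.
  rewrite /series/= big_ltn// big_ltn//= /exp_coeff /= expr0 expr1 fact0 /= !divr1.
  lra.
apply: (ler_cvg_to (phiE (t * x)) (cvgM (cvg_cst (t ^+ 2)) (phiE x))).
near=> n; rewrite /= !step mulr_sumr ler_sum_nat// => i /andP[i2 _].
rewrite /exp_coeff /= mulrA ler_wpM2r ?invr_ge0// exprMn ler_wpM2r ?exprn_ge0//.
rewrite (le_trans (ler_norm _))// normrX -(real_normK (num_real t)) ler_wiXn2l//.
Unshelve. all: end_near. Qed.

Lemma phi_le x a : `|x| <= a -> phi x <= phi a.
Proof.
move=> xa; have a0 : 0 <= a by rewrite (le_trans _ xa).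
have [a00|an0] := eqVneq a 0.
  by move: xa; rewrite a00 normr_le0 => /eqP ->.
have t1 : `|x / a| <= 1.
  by rewrite normrM normfV (ger0_norm a0) ler_pdivrMr ?mul1r// lt_def an0.
have := phi_scale t1 a0; rewrite divfK// => /le_trans; apply.
by rewrite ler_piMl ?phi_ge0// -(real_normK (num_real _)) exprn_ile1.
Qed.

Lemma measurable_phi : measurable_fun [set: R] phi.
Proof. by apply: measurable_funB => //; apply: measurable_funB. Qed.

(** The step of a walk that moves up with probability p; its iterates average u
    against binomial laws. *)
Definition bern p u : nat -> R := fun k => (1 - p) * u k + p * u k.+1.

Lemma bern_mono p u v : 0 <= p <= 1 -> (forall k, u k <= v k) ->
  forall k, bern p u k <= bern p v k.
Proof.
by move=> /andP[p0 p1] uv k; rewrite lerD// ler_wpM2l// subr_ge0.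
Qed.

Lemma iter_bern_mono p u v n : 0 <= p <= 1 -> (forall k, u k <= v k) ->
  forall k, iter n (bern p) u k <= iter n (bern p) v k.
Proof. by move=> p01 uv; elim: n => //= n IH k; exact: bern_mono. Qed.

Lemma iter_bernDc p u (c : R) n k :
  iter n (bern p) (fun j => u j + c) k = iter n (bern p) u k + c.
Proof. by elim: n k => //= n IH k; rewrite /bern !IH; ring. Qed.

Lemma iter_bern_cst p (c : R) n k : iter n (bern p) (fun=> c) k = c.
Proof. by elim: n k => //= n IH k; rewrite /bern !IH; ring. Qed.

(** A monotone operator that commutes with the addition of constants is
    nonexpansive for the uniform norm. *)
Lemma iter_bern_contract p u v n e : 0 <= p <= 1 ->
  (forall k, `|u k - v k| <= e) ->
  forall k, `|iter n (bern p) u k - iter n (bern p) v k| <= e.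
Proof.
move=> p01 uv k.
have le12 (u1 u2 : nat -> R) : (forall k, `|u1 k - u2 k| <= e) ->
    iter n (bern p) u1 k <= iter n (bern p) u2 k + e.
  move=> h; rewrite -iter_bernDc; apply: iter_bern_mono => // j.
  by have := h j; rewrite ler_norml => /andP[_]; lra.
have h1 := le12 _ _ uv.
have h2 : iter n (bern p) v k <= iter n (bern p) u k + e.
  by apply: le12 => j; rewrite distrC.
by rewrite ler_norml; apply/andP; split; lra.
Qed.

Lemma iter_bern_lip p u a n : 0 <= p <= 1 ->
  (forall k, `|u k.+1 - u k| <= a) ->
  forall k, `|iter n (bern p) u k.+1 - iter n (bern p) u k| <= a.
Proof.
move=> p01 ua k.
have -> : iter n (bern p) u k.+1 = iter n (bern p) (u \o succn) k.
  by elim: n k => //= n IH k; rewrite /bern !IH.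
exact: iter_bern_contract.
Qed.

(** After division by [expR (u k)] the left-hand side is 1 + p b + p phi b, where
    b is an increment of u, and 1 + y <= e^y. *)
Lemma bern_exp p u a : 0 <= p <= 1 -> (forall k, `|u k.+1 - u k| <= a) ->
  forall k, bern p (expR \o u) k <= expR (bern p u k + p * phi a).
Proof.
move=> p01 ua k; rewrite /bern /=.
set b := u k.+1 - u k.
have -> : u k.+1 = u k + b by rewrite /b; ring.
have -> : (1 - p) * expR (u k) + p * expR (u k + b) =
    expR (u k) * (1 + p * (expR b - 1)) by rewrite expRD; ring.
have -> : (1 - p) * u k + p * (u k + b) + p * phi a =
  u k + (p * b + p * phi a) by ring.
rewrite expRD ler_pM2l ?expR_gt0// (le_trans (expR_ge1Dx _))// ler_expR.
have := phi_le (ua k); rewrite -/b /(phi b) => h.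
by rewrite -mulrDr ler_wpM2l//; [case/andP: p01|lra].
Qed.

(** Averaging does not enlarge increments, so every step of the walk costs the
    same p phi a. *)
Lemma iter_bern_exp p u a n : 0 <= p <= 1 -> (forall k, `|u k.+1 - u k| <= a) ->
  forall k, iter n (bern p) (expR \o u) k <=
    expR (iter n (bern p) u k + n%:R * p * phi a).
Proof.
move=> p01 ua; elim: n => [|n IH] k; first by rewrite !mul0r addr0.
rewrite iterS; apply: le_trans (bern_mono p01 IH k) _.
have -> : bern p (fun j => expR (iter n (bern p) u j + n%:R * p * phi a)) k =
    expR (n%:R * p * phi a) * bern p (expR \o iter n (bern p) u) k.
  by rewrite /bern /= !expRD; ring.
have := bern_exp p01 (iter_bern_lip n p01 ua) k.
rewrite -(ler_pM2l (expR_gt0 (n%:R * p * phi a))) => /le_trans; apply.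
by rewrite -expRD ler_expR -natr1 /=; lra.
Qed.

(** The walk of parameter p is changed into that of parameter q one step at a
    time; each change moves a mass |p - q| by one unit. *)
Lemma iter_bern_rate p q u a n : 0 <= p <= 1 -> 0 <= q <= 1 ->
  (forall k, `|u k.+1 - u k| <= a) ->
  forall k, `|iter n (bern p) u k - iter n (bern q) u k| <= n%:R * `|p - q| * a.
Proof.
move=> p01 q01 ua; elim: n => [|n IH] k; first by rewrite subrr normr0 !mul0r.
rewrite !iterS.
set U := iter n (bern p) u; set V := iter n (bern q) u.
have -> : bern p U k - bern q V k =
    (p - q) * (U k.+1 - U k) + (bern q U k - bern q V k) by rewrite /bern; ring.
have -> : n.+1%:R * `|p - q| * a = `|p - q| * a + n%:R * `|p - q| * a
  by rewrite -natr1; ring.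
rewrite (le_trans (ler_normD _ _))// lerD//.
  by rewrite normrM ler_wpM2l// iter_bern_lip.
exact: (@iter_bern_contract q U V 1).
Qed.

Lemma iter_bernE p u n k : iter n (bern p) u k =
  \sum_(j < n.+1) binomial_pmf n p j * u (k + j)%N.
Proof.
elim: n u k => [|n IH] u k.
  by rewrite big_ord1 /binomial_pmf /= addn0 !expr0 bin0; ring.
rewrite iterSr IH /bern.
under eq_bigr do rewrite mulrDr (mulrCA _ (1 - p)) (mulrCA _ p).
rewrite big_split/=.
have e1 : \sum_(j < n.+1) (1 - p) * (binomial_pmf n p j * u (k + j)%N) =
   \sum_(j < n.+2) (1 - p) * (binomial_pmf n p j * u (k + j)%N).
  by rewrite [RHS]big_ord_recr/= [binomial_pmf n p n.+1]/binomial_pmf bin_small// mulr0n mul0r mulr0 addr0.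
rewrite e1 [X in X + _]big_ord_recl [RHS]big_ord_recl -addrA; congr (_ + _).
  by rewrite /binomial_pmf !bin0 !expr0 !subn0 exprS !mulr1n /unstable.onem; ring.
rewrite -big_split /=; apply: eq_bigr => i _.
rewrite /bump /= !add1n addnS -addnS; rewrite !mulrA -mulrDl; congr (_ * _).
rewrite /binomial_pmf binS mulrnDr subSS; congr (_ + _); last first.
  by rewrite exprS mulrnAr !mulrA.
(* i = n is apart: there n - i.+1 is not the predecessor of n - i. *)
have [ni|ni] := ltnP n i.+1; first by rewrite bin_small// !mulr0n mulr0.
rewrite -(subnSK ni) [in RHS](exprS _ (n - i.+1)) mulrnAr; congr (_ *+ _).
by rewrite /unstable.onem mulrCA.
Qed.

End elementary.

(** * Poisson averages as limits of binomial averages *)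
Section poisson_limit.
Local Open Scope ring_scope.
Context {R : realType}.
Implicit Types (p a m x y t : R) (u v : nat -> R).

(** For m = 0 this is the Dirac mass at 0, the law of the count of a null set. *)
Definition pois m k : R := exp_coeff m k * expR (- m).

Lemma pois_ge0 m k : 0 <= m -> 0 <= pois m k.
Proof. by move=> m0; rewrite mulr_ge0 ?expR_ge0// exp_coeff_ge0. Qed.

Let p_ m (n : nat) : R := m / n.+1%:R.

Let cvg_p m : p_ m n @[n --> \oo] --> 0.
Proof.
rewrite -[X in _ --> X](mulr0 m); apply: cvgM; first exact: cvg_cst.
exact: cvg_harmonic.
Qed.

Let p01 m : 0 <= m -> \forall n \near \oo, 0 <= p_ m n < 1.
Proof.
move=> m0; have /cvgrPdist_lt/(_ 1 ltr01) := cvg_p m.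
apply: filterS => n; rewrite sub0r normrN => h; rewrite divr_ge0//=.
by rewrite (le_lt_trans (ler_norm _)).
Qed.

(** Both sides of the squeeze are 1 + y <= e^y, at y = - p and at y = p / (1 - p). *)
Lemma binomial_pmf0_cvg m : 0 <= m ->
  (1 - p_ m n) ^+ n.+1 @[n --> \oo] --> expR (- m).
Proof.
move=> m0.
apply: (@squeeze_cvgr _ _ _ _ (fun n => expR (- (m / (1 - p_ m n)))) (fun=> expR (- m))).
- near=> n.
  have /andP[q0 q1] : 0 <= p_ m n < 1 by near: n; exact: p01.
  have q1' : 0 < 1 - p_ m n by rewrite subr_gt0.
  have e : m = n.+1%:R * p_ m n by rewrite /p_ mulrCA mulfV ?mulr1// pnatr_eq0.
  apply/andP; split.
    have -> : - (m / (1 - p_ m n)) = n.+1%:R * (- (p_ m n / (1 - p_ m n))).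
      by rewrite {1}e; ring.
    rewrite expRM_natl lerXn2r ?nnegrE ?expR_ge0 ?(ltW q1')//.
    rewrite expRN -[leRHS]invrK lef_pV2 ?posrE ?expR_gt0 ?invr_gt0//.
    apply: le_trans (expR_ge1Dx _).
    by rewrite le_eqVlt; apply/orP; left; apply/eqP; field; rewrite gt_eqF.
  have -> : - m = n.+1%:R * (- p_ m n) by rewrite {1}e; ring.
  rewrite expRM_natl lerXn2r ?nnegrE ?expR_ge0 ?(ltW q1')//.
  exact: expR_ge1Dx.
- apply: continuous_cvg; first exact: continuous_expR.
  rewrite -[X in _ --> - X]divr1; apply: cvgN; apply: cvgM; first exact: cvg_cst.
  apply: cvgV => //.
  by rewrite -[X in _ --> X]subr0; apply: cvgB; [exact: cvg_cst|exact: cvg_p].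
- exact: cvg_cst.
Unshelve. all: end_near. Qed.

(** The ratios of consecutive binomial masses converge to m / k.+1. *)
Lemma binomial_pmf_cvg m k : 0 <= m ->
  binomial_pmf n.+1 (p_ m n) k @[n --> \oo] --> pois m k.
Proof.
move=> m0; elim: k => [|k IH].
  rewrite /pois /exp_coeff /= expr0 fact0 divr1 mul1r.
  under eq_fun do rewrite /binomial_pmf bin0 expr0 mul1r mulr1n subn0.
  exact: binomial_pmf0_cvg.
have -> : pois m k.+1 = pois m k * ((m - k%:R * 0) / k.+1%:R / (1 - 0)).
  rewrite /pois /exp_coeff /= factS exprS natrM.
  have ? : (k`!%:R : R) != 0 by rewrite pnatr_eq0 -lt0n fact_gt0.
  by field; rewrite !gt_eqF// ltr0n fact_gt0.
have cv : (binomial_pmf n.+1 (p_ m n) k *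
    ((m - k%:R * p_ m n) / k.+1%:R / (1 - p_ m n))) @[n --> \oo] -->
    pois m k * ((m - k%:R * 0) / k.+1%:R / (1 - 0)).
  apply: cvgM => //; apply: cvgM.
    apply: cvgM; last exact: cvg_cst.
    apply: cvgB; first exact: cvg_cst.
    by apply: cvgM; [exact: cvg_cst|exact: cvg_p].
  apply: cvgV; first by rewrite subr0 oner_eq0.
  by apply: cvgB; [exact: cvg_cst|exact: cvg_p].
apply: cvg_trans cv.
apply: near_eq_cvg; near=> n.
have /andP[q0 q1] : 0 <= p_ m n < 1 by near: n; exact: p01.
have kn : (k < n.+1)%N by near: n; exists k => // j /= kj; rewrite ltnS.
rewrite /= /binomial_pmf.
have -> : (n.+1 - k = (n.+1 - k.+1).+1)%N by rewrite subnSK.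
have := mul_bin_left n.+1 k => /(congr1 (fun i => i%:R : R)); rewrite !natrM natrB; last exact: ltnW.
move=> h; rewrite -[in RHS]mulr_natr.
have -> : 'C(n.+1, k.+1)%:R = (n.+1%:R - k%:R) * 'C(n.+1, k)%:R / k.+1%:R :> R.
  by rewrite -h; field; rewrite gt_eqF// ltr0n.
have -> : (m - k%:R * p_ m n) = p_ m n * (n.+1%:R - k%:R).
  by rewrite mulrBr (mulrC k%:R); congr (_ - _); rewrite /p_ divfK// pnatr_eq0.
rewrite !exprS -mulr_natr /unstable.onem.
by field; rewrite !gt_eqF ?subr_gt0//= ltr0n.
Unshelve. all: end_near. Qed.

(** A summable bound, uniform in n, for the passage to the Poisson limit. *)
Lemma binomial_pmf_le m n k : 0 <= m -> 0 <= p_ m n < 1 ->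
  binomial_pmf n.+1 (p_ m n) k <= exp_coeff m k.
Proof.
move=> m0 /andP[q0 q1]; rewrite /binomial_pmf /exp_coeff /= -mulr_natr.
have ff : (n.+1 ^_ k <= n.+1 ^ k)%N.
  elim: k => // k IH; rewrite ffactnSr expnSr leq_mul// leq_subr //.
have h : 'C(n.+1, k)%:R <= n.+1%:R ^+ k / k`!%:R :> R.
  by rewrite ler_pdivlMr ?ltr0n ?fact_gt0// -natrM bin_ffact -natrX ler_nat.
have -> : m ^+ k / k`!%:R = p_ m n ^+ k * 1 * (n.+1%:R ^+ k / k`!%:R).
  by rewrite mulr1 mulrA -exprMn /p_ divfK// gt_eqF// ltr0n.
have q1' : 0 <= 1 - p_ m n by rewrite subr_ge0 ltW.
rewrite /unstable.onem ler_pM ?mulr_ge0 ?exprn_ge0 ?ler0n//.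
by rewrite ler_wpM2l ?exprn_ge0// exprn_ile1// lerBlDr lerDl.
Qed.

(** The mean of u under the Poisson law of mean m. Defined as a binomial limit, it
    inherits at once the bounds on Bernoulli walks; [pavg_series] gives its series. *)
Definition pavg m u : R := limn (fun n => iter n.+1 (bern (m / n.+1%:R)) u 0%N).

(** Dominated convergence of the binomial averages for the counting measure. *)
Lemma pavg_series m u C : 0 <= m -> (forall k, 0 <= u k <= C) ->
  iter n.+1 (bern (m / n.+1%:R)) u 0%N @[n --> \oo] --> pavg m u /\
  (\sum_(0 <= k <oo) (pois m k * u k)%:E = (pavg m u)%:E)%E.
Proof.
move=> m0 uC.
have u0 k : 0 <= u k by case/andP: (uC k).
have C0 : 0 <= C by case/andP: (uC 0%N) => /le_trans; exact.
have mnat (f : nat -> \bar R) : measurable_fun [set: nat] f by move=> _ Y _.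
pose fn n k : \bar R := (binomial_pmf n.+1 (p_ m n) k * u k)%:E.
(* From N0 on, m / n.+1 is a probability; the sequence is shifted by N0. *)
have [N0 _ HN0] := p01 m0.
have fn0 n k : (N0 <= n)%N -> (0 <= fn n k)%E.
  move=> /HN0/=/andP[q0 q1]; rewrite lee_fin mulr_ge0//.
  by rewrite binomial_pmf_ge0// q0 ltW.
have intfn n : (N0 <= n)%N -> (\int[counting]_k fn n k = (iter n.+1 (bern (p_ m n)) u 0%N)%:E)%E.
  move=> Nn; rewrite ge0_integral_count; last by move=> k; exact: fn0.
  rewrite (nneseries_split _ n.+2); last by move=> k _; exact: fn0.
  rewrite [X in (_ + X)%E]eseries0 ?adde0.
    rewrite iter_bernE -sumEFin; rewrite add0n big_mkord.
    by apply: eq_bigr => i _; rewrite add0n.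
  by move=> i + _; rewrite add0n => ni; rewrite /fn /binomial_pmf bin_small// mulr0n mul0r.
have exps : (\sum_(0 <= k <oo) (exp_coeff m k * C)%:E = (expR m * C)%:E)%E.
  rewrite EFinM expRE [RHS]muleC.
  under eq_eseriesr do rewrite mulrC EFinM.
  rewrite nneseriesZl; last by move=> k _; rewrite lee_fin exp_coeff_ge0.
  congr (_ * _)%E; rewrite -EFin_lim; last first.
    rewrite /pseries/=; under eq_fun do rewrite mulrC.
    exact: is_cvg_series_exp_coeff.
  apply/congr_lim/funext => n/=; rewrite /pseries/= /series/= -sumEFin//.
  by under [RHS]eq_bigr do rewrite mulrC.
have [|||||] := @dominated_convergence _ nat R counting setT measurableT
  (fun n => fn (N0 + n)%N) (fun k => (pois m k * u k)%:E) (fun k => (exp_coeff m k * C)%:E) _ _ _ _ _.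
- by move=> n; exact: mnat.
- exact: mnat.
- apply: aeW => k _; rewrite /fn; apply/cvg_EFin; first by apply: nearW.
  have cvk : binomial_pmf (N0 + n).+1 (p_ m (N0 + n)%N) k @[n --> \oo] --> pois m k.
    exact: (cvg_comp _ _ (cvg_addnl N0) (@binomial_pmf_cvg m k m0)).
  exact: (cvgM cvk (cvg_cst (u k))).
- apply/integrableP; split; first exact: mnat.
  rewrite (eq_integral (fun k => (exp_coeff m k * C)%:E)); last first.
    by move=> k _; rewrite gee0_abs// lee_fin mulr_ge0 ?exp_coeff_ge0.
  rewrite ge0_integral_count; last by move=> k; rewrite lee_fin mulr_ge0 ?exp_coeff_ge0.
  by rewrite exps ltry.
- apply: aeW => k n _; rewrite gee0_abs ?fn0 ?leq_addr// lee_fin.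
  have /andP[q0 q1] : 0 <= p_ m (N0 + n) < 1 by apply: HN0 => /=; rewrite leq_addr.
  rewrite ler_pM//; first by rewrite binomial_pmf_ge0// q0 ltW.
    by rewrite binomial_pmf_le// q0.
  by case/andP: (uC k).
move=> _ _ cv.
have s0 k : (0 <= (pois m k * u k)%:E)%E by rewrite lee_fin mulr_ge0// pois_ge0.
rewrite ge0_integral_count// in cv.
have sfin : (\sum_(0 <= k <oo) (pois m k * u k)%:E \is a fin_num)%E.
  rewrite ge0_fin_numE; last exact: nneseries_ge0.
  apply: (@le_lt_trans _ _ (\sum_(0 <= k <oo) (exp_coeff m k * C)%:E)%E); last by rewrite exps ltry.
  apply: lee_nneseries => // k _; rewrite lee_fin ler_pM// ?pois_ge0//; last by case/andP: (uC k).
  by rewrite /pois ler_piMr ?exp_coeff_ge0// -expR0 ler_expR; lra.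
set S := (\sum_(0 <= k <oo) (pois m k * u k)%:E)%E in cv sfin *.
have cv' : iter n.+1 (bern (p_ m n)) u 0%N @[n --> \oo] --> fine S.
  rewrite -(cvg_shiftn N0); rewrite -(fineK sfin) in cv.
  apply: cvg_trans (fine_cvg cv); apply: near_eq_cvg; apply: nearW => n /=.
  by rewrite intfn ?leq_addr// addnC.
have -> : pavg m u = fine S by apply: cvg_lim cv'.
by rewrite fineK.
Qed.

End poisson_limit.

Section poisson_average.
Local Open Scope ring_scope.
Context {R : realType}.
Implicit Types (p a m x y t : R) (u v : nat -> R).

Let near01 m : 0 <= m -> \forall n \near \oo, 0 <= m / n.+1%:R <= 1.
Proof.
move=> m0; near=> n; rewrite divr_ge0//= ler_pdivrMr ?ltr0n// mul1r.
by rewrite (@le_trans _ _ n%:R) ?ler_nat//; near: n; exact: nbhs_infty_ger.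
Unshelve. all: end_near. Qed.

Lemma pavg_bound m u C : 0 <= m -> (forall k, 0 <= u k <= C) ->
  0 <= pavg m u <= C.
Proof.
move=> m0 uC; have [cv _] := pavg_series m0 uC.
have h : \forall n \near \oo, 0 <= iter n.+1 (bern (m / n.+1%:R)) u 0%N <= C.
  apply: filterS (near01 m0) => n p01.
  rewrite -[X in X <= _ <= _](iter_bern_cst (m / n.+1%:R) 0 n.+1 0).
  rewrite -[X in _ <= _ <= X](iter_bern_cst (m / n.+1%:R) C n.+1 0).
  by apply/andP; split; apply: iter_bern_mono => // k; case/andP: (uC k).
apply/andP; split.
  by apply: (cvgr_to_ge cv); apply: filterS h => n /andP[].
by apply: (cvgr_to_le cv); apply: filterS h => n /andP[].
Qed.

Lemma pavg_addc m u C k0 : 0 <= m -> (forall k, 0 <= u k <= C) ->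
  pavg m (fun k => u k + k0) = pavg m u + k0.
Proof.
move=> m0 uC; have [cv _] := pavg_series m0 uC.
apply: cvg_lim => //; under eq_fun do rewrite iter_bernDc.
by apply: cvgD => //; exact: cvg_cst.
Qed.

Lemma pavg_mono m u v C D : 0 <= m -> (forall k, 0 <= u k <= C) ->
  (forall k, 0 <= v k <= D) -> (forall k, u k <= v k) -> pavg m u <= pavg m v.
Proof.
move=> m0 uC vC uv; have [cu _] := pavg_series m0 uC.
have [cv _] := pavg_series m0 vC.
apply: (ler_cvg_to cu cv); apply: filterS (near01 m0) => n p01.
exact: iter_bern_mono.
Qed.

Lemma pavg_contract m u v C D e : 0 <= m -> (forall k, 0 <= u k <= C) ->
  (forall k, 0 <= v k <= D) -> (forall k, `|u k - v k| <= e) ->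
  `|pavg m u - pavg m v| <= e.
Proof.
move=> m0 uC vC uv; have [cu _] := pavg_series m0 uC.
have [cv _] := pavg_series m0 vC.
apply: (cvgr_to_le (cvg_norm (cvgB cu cv))).
apply: filterS (near01 m0) => n p01.
exact: iter_bern_contract.
Qed.

Lemma pavg_exp m u C a : 0 <= m -> (forall k, 0 <= u k <= C) ->
  (forall k, `|u k.+1 - u k| <= a) ->
  pavg m (expR \o u) <= expR (pavg m u + m * phi a).
Proof.
move=> m0 uC ua; have [cu _] := pavg_series m0 uC.
have eC k : 0 <= (expR \o u) k <= expR C.
  by rewrite /= expR_ge0 ler_expR; case/andP: (uC k).
have [ce _] := pavg_series m0 eC.
apply: (@ler_cvg_to _ _ _ _ _ (fun n => expR (iter n.+1 (bern (m / n.+1%:R)) u 0%N + m * phi a)) _ _ ce).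
  apply: continuous_cvg; first exact: continuous_expR.
  by apply: cvgD => //; exact: cvg_cst.
apply: filterS (near01 m0) => n p01.
have := iter_bern_exp n.+1 p01 ua 0%N.
by rewrite [_ * (m / _)]mulrC divfK// pnatr_eq0.
Qed.

Lemma pavg_rate m m' u C a : 0 <= m -> 0 <= m' -> (forall k, 0 <= u k <= C) ->
  (forall k, `|u k.+1 - u k| <= a) ->
  `|pavg m u - pavg m' u| <= `|m - m'| * a.
Proof.
move=> m0 m0' uC ua; have [cu _] := pavg_series m0 uC.
have [cv _] := pavg_series m0' uC.
apply: (cvgr_to_le (cvg_norm (cvgB cu cv))).
apply: filterS2 (near01 m0) (near01 m0') => n p01 p01'.
apply: le_trans (iter_bern_rate n.+1 p01 p01' ua 0%N) _.
by rewrite -mulrBl normrM mulrCA normfV [`|n.+1%:R|]ger0_norm// mulfV ?mulr1// pnatr_eq0.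
Qed.

End poisson_average.

Section compound.
Local Open Scope ring_scope.
Context {R : realType}.
Implicit Types (x y L C : R) (m c : nat -> R) (f g : R -> R).

Definition jumpavg (mu c : R) f : R -> R :=
  fun x => pavg mu (fun k => f (x + c * k%:R)).

(** The mean of f (x + \sum_(i < n) c i * N_i) for independent Poisson variables
    N_i of means m i, integrated out one at a time. *)
Fixpoint compound n m c f : R -> R :=
  if n is n'.+1 then jumpavg (m n') (c n') (compound n' m c f) else f.

Definition lipschitz_with L f := forall x y, `|f x - f y| <= L * `|x - y|.

Lemma compound_bound n m c f C : (forall i, 0 <= m i) ->
  (forall x, 0 <= f x <= C) -> forall x, 0 <= compound n m c f x <= C.
Proof. by move=> m0 fC; elim: n => //= n IH x; apply: pavg_bound. Qed.

Lemma compound_lip n m c f C L : (forall i, 0 <= m i) ->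
  (forall x, 0 <= f x <= C) -> lipschitz_with L f ->
  lipschitz_with L (compound n m c f).
Proof.
move=> m0 fC fL; elim: n => //= n IH x y.
have bd := compound_bound n c m0 fC.
apply: (@pavg_contract _ _ _ _ C C) => // k.
by rewrite (le_trans (IH _ _))// opprD addrACA subrr addr0.
Qed.

Let jump_step L f (c x : R) k : lipschitz_with L f ->
  `|f (x + c * k.+1%:R) - f (x + c * k%:R)| <= L * `|c|.
Proof.
move=> fL; rewrite (le_trans (fL _ _))//.
by rewrite opprD addrACA subrr add0r -mulrBr -natr1 addrAC subrr add0r mulr1.
Qed.

(** Tensorization: the average over some of the coordinates is still Lipschitz, so
    the bound for one Poisson variable applies to the next coordinate and the
    costs add up. *)
Lemma compound_exp n m c f C L : (forall i, 0 <= m i) ->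
  (forall x, 0 <= f x <= C) -> lipschitz_with L f -> forall x,
  compound n m c (expR \o f) x <=
    expR (compound n m c f x + \sum_(i < n) m i * phi (L * `|c i|)).
Proof.
move=> m0 fC fL; elim: n => [|n IH] x /=; first by rewrite big_ord0 addr0.
have bd := compound_bound n c m0 fC.
have lp := compound_lip n c m0 fC fL.
set K := \sum_(i < n) m i * phi (L * `|c i|) in IH *.
have K0 : 0 <= K by apply: sumr_ge0 => i _; rewrite mulr_ge0// phi_ge0.
have ef y : 0 <= (expR \o f) y <= expR C.
  by rewrite /= expR_ge0 ler_expR; case/andP: (fC y).
rewrite big_ord_recr/= -/K addrA.
pose u k := compound n m c f (x + c n * k%:R) + K.
have uC k : 0 <= u k <= C + K.
  by rewrite /u; case/andP: (bd (x + c n * k%:R)) => *; rewrite addr_ge0// lerD2r.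
have -> : compound n.+1 m c f x + K = pavg (m n) u.
  by rewrite /u (pavg_addc K (m0 n) (fun k => bd (x + c n * k%:R))).
apply: le_trans (_ : pavg (m n) (expR \o u) <= _); last first.
  apply: (@pavg_exp _ _ _ (C + K)) => // k.
  by rewrite /u opprD addrACA subrr addr0; exact: jump_step.
apply: (@pavg_mono _ _ _ _ (expR C) (expR (C + K))) => // k.
  exact: compound_bound.
by rewrite /= expR_ge0 ler_expR; case/andP: (uC k).
Qed.

(** The means are changed one coordinate at a time, each at the cost given by
    [pavg_rate]. *)
Lemma compound_rate n m m' c f C L : (forall i, 0 <= m i) ->
  (forall i, 0 <= m' i) ->
  (forall x, 0 <= f x <= C) -> lipschitz_with L f -> forall x,
  `|compound n m c f x - compound n m' c f x| <=
    L * \sum_(i < n) `|c i| * `|m i - m' i|.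
Proof.
move=> m0 m0' fC fL; elim: n => [|n IH] x /=.
  by rewrite subrr normr0 big_ord0 mulr0.
rewrite big_ord_recr/= mulrDr.
rewrite (le_trans (ler_distD (jumpavg (m' n) (c n) (compound n m c f) x) _ _))// addrC.
have bd := compound_bound n c m0 fC.
have lp := compound_lip n c m0 fC fL.
rewrite lerD//.
  apply: (@pavg_contract _ _ _ _ C C) => // k; exact: compound_bound.
rewrite mulrA mulrC.
by apply: (@pavg_rate _ _ _ _ C) => // k; exact: jump_step.
Qed.

End compound.

(** * The quantile coupling *)

Section quantile.
Local Open Scope ring_scope.
Context {R : realType} (s : probability R R).
Implicit Types (u x : R).

(** Cut off outside ]0, 1[, where the infimum may be over an empty or an unbounded
    set. *)
Definition quantile : measurableTypeR R -> R :=
  (fun u => inf [set x | (u%:E <= s `]-oo, x]%classic)%E]) \_ `]0, 1[%classic.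

Let idR : R -> R := idfun.
#[local] HB.instance Definition _ :=
  @isMeasurableFun.Build _ _ _ _ idR (@measurable_id _ _ setT).
Let F x : R := fine (cdf (idR : {RV s >-> R}) x).

Let FE x : s `]-oo, x]%classic = (F x)%:E.
Proof. by rewrite /F fineK// fin_num_measure. Qed.

Let ndF : {homo F : a b / a <= b}.
Proof.
by move=> a b ab; rewrite /F fine_le ?fin_num_measure//; exact: cdf_nondecreasing.
Qed.

(** Right continuity of the distribution function makes the infimum a minimum. *)
Lemma quantile_le u x : 0 < u < 1 -> (quantile u <= x) = (u%:E <= s `]-oo, x]%classic)%E.
Proof.
move=> /andP[u0 u1]; rewrite /quantile patchE ifT; last by rewrite inE/= in_itv/= u0.
set S := [set x | _].
have SE y : S y = (u <= F y) :> Prop by rewrite /S/= FE lee_fin.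
rewrite FE lee_fin.
have S0 : S !=set0.
  have : \forall x \near +oo, u < F x.
    by apply: (cvgr_gt (1:R)) => //; apply/fine_cvg/cvg_cdfy1.
  case=> M [_ /(_ (M + 1))]; rewrite ltrDl ltr01 => /(_ isT) h.
  by exists (M + 1); rewrite SE ltW.
have [l Sl] : exists l, lbound S l.
  have : \forall x \near -oo, F x < u.
    by apply: (cvgr_lt (0:R)) => //; apply/fine_cvg/cvg_cdfNy0.
  case=> M [_ /(_ (M - 1))]; rewrite ltrBlDr ltrDl ltr01 => /(_ isT) h.
  exists (M - 1) => y; rewrite SE => Sy.
  rewrite leNgt; apply/negP => /ltW /ndF /(le_trans Sy) h'.
  by move: h; rewrite ltNge h'.
have Sup a b : a <= b -> S a -> S b.
  by move=> ab; rewrite !SE => /le_trans; apply; exact: ndF.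
have Sinf : S (inf S).
  rewrite SE leNgt; apply/negP => h.
  have hn : \forall x \near (inf S)^'+, F x < u.
    apply: (cvgr_lt (F (inf S))) => //; apply: fine_cvg.
    rewrite /F fineK ?fin_num_measure//.
    exact: cdf_right_continuous.
  have : \forall x \near (inf S)^'+, F x < u /\ inf S < x.
    by near=> y; split; near: y => //; exact: nbhs_right_gt.
  case/(@filter_ex _ _ (at_right_proper_filter _)) => y [Fy yS].
  have [z Sz zy] : exists2 z, S z & z < y.
    have [z Sz] := @inf_adherent _ S (y - inf S) (ltac:(by rewrite subr_gt0)) (conj S0 (ex_intro _ l Sl)).
    by rewrite addrC subrK; exists z.
  have := Sup _ _ (ltW zy) Sz; rewrite SE => /le_lt_trans /(_ Fy).
  by rewrite ltxx.
apply/idP/idP => [qx|ux]; first by have := Sup _ _ qx Sinf; rewrite SE.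
by apply: ge_inf; [exists l|rewrite SE].
Unshelve. all: end_near. Qed.

Lemma measurable_quantile : measurable_fun [set: measurableTypeR R] quantile.
Proof.
apply/(measurable_restrictT _ _).1 => //.
apply: (@eq_measurable_fun _ _ _ _ _ quantile).
  by move=> u u01; rewrite /quantile patchE ifT.
move=> mD; apply: (measurability (@RGenCInfty.G R)) mD => [|/= _ [_] [r] -> <-].
  exact: RGenCInfty.measurableE.
(* [quantile_le] makes the preimages of half-lines intervals. *)
apply: is_interval_measurable => a b /= [a01 ra] [b01 rb] z /andP[az zb].
have z01 : 0 < z < 1.
  move: a01 b01; rewrite /= !in_itv/= => /andP[a0 _] /andP[_ b1].
  by rewrite (lt_le_trans a0)// (le_lt_trans zb).
split; first by rewrite /= in_itv.
move: ra; rewrite /= !in_itv/= !andbT => /le_trans; apply.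
have a01' : 0 < a < 1 by move: a01; rewrite /= in_itv.
rewrite quantile_le//.
by rewrite (@le_trans _ _ z%:E) ?lee_fin// -quantile_le.
Qed.

HB.instance Definition _ :=
  @isMeasurableFun.Build _ _ _ _ quantile measurable_quantile.

End quantile.

Section unit_interval.
Context {R : realType}.

Definition unif01 : set (measurableTypeR R) -> \bar R :=
  mrestr lebesgue_measure (measurable_itv `]0%R, 1%R[).

HB.instance Definition _ := Measure.on unif01.

Let unif01_setT : unif01 setT = 1.
Proof.
rewrite /unif01 /mrestr setTI lebesgue_measure_itv/= lte_fin ltr01.
by rewrite oppr0 adde0.
Qed.

HB.instance Definition _ :=
  @Measure_isProbability.Build _ _ R unif01 unif01_setT.

Lemma probability_eq_cdf (s1 s2 : probability R R) :
  (forall x : R, s1 `]-oo, x]%classic = s2 `]-oo, x]%classic) ->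
  forall A, measurable A -> s1 A = s2 A.
Proof.
move=> s12 A mA.
apply: (measure_unique (@RGenOInfty.G R) (fun k => `](- k%:R)%R, +oo[%classic)) => //.
- exact: RGenOInfty.measurableE.
- move=> _ _ [x ->] [y ->]; exists (Num.max x y); apply/seteqP.
  split => z /=; rewrite !in_itv/= !andbT gt_max; first by move=> [-> ->].
  by move=> /andP[].
- by move=> i; exists (- i%:R)%R.
- apply/seteqP; split => // x _; exists (Num.bound x) => //=.
  by rewrite in_itv/= andbT ltrNl unstable.ltrNbound.
- move=> _ [x ->]; rewrite -setCitvl.
  have e (s : probability R R) :
      s (~` `]-oo, x]%classic) = 1 - s `]-oo, x]%classic.
    exact: probability_setC.
  by apply: (etrans (e s1)); rewrite s12; exact/esym/e.
- by move=> k; rewrite (le_lt_trans (probability_le1 _ _)) ?ltry.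
Qed.

(** By [quantile_le], the event that the quantile is at most x is an interval with
    endpoints 0 and F x, where F is the distribution function of s. *)
Lemma distribution_quantile (s : probability R R) A : measurable A ->
  distribution unif01 (quantile s) A = s A.
Proof.
move=> mA; apply: probability_eq_cdf => // x.
rewrite /distribution /pushforward /unif01 /mrestr.
have r0 : (0 <= fine (s `]-oo, x]%classic))%R by rewrite fine_ge0.
have r1 : (fine (s `]-oo, x]%classic) <= 1)%R.
  by rewrite -lee_fin fineK ?fin_num_measure// probability_le1.
have sE : s `]-oo, x]%classic = (fine (s `]-oo, x]%classic))%:E.
  by rewrite fineK ?fin_num_measure.
set r := fine _ in r0 r1 sE.
transitivity (lebesgue_measure
    (if (r < 1)%R then `]0%R, r]%classic else `]0%R, 1%R[%classic)).
  congr (lebesgue_measure _).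
  apply/seteqP; split => u /=.
    move=> [+ u01]; rewrite in_itv/= quantile_le; last by move: u01; rewrite in_itv.
    rewrite sE lee_fin; move: u01; case: ifPn => //= _; rewrite !in_itv/= => /andP[-> _].
    by move=> ->.
  case: ifPn => [r_lt|]; rewrite /= !in_itv/=.
    move=> /andP[u0 ur]; have u01 : (0 < u < 1)%R by rewrite u0 (le_lt_trans ur).
    by rewrite quantile_le// sE lee_fin.
  rewrite -leNgt => r1' u01; split => //; rewrite quantile_le// sE lee_fin.
  by rewrite (le_trans _ r1')//; case/andP: u01 => _ /ltW.
rewrite sE; case: ifPn => [rl1|]; rewrite lebesgue_measure_itv/= lte_fin ?ltr01.
  case: ltP => [_|r0']; first by rewrite oppr0 adde0.
  by congr EFin; apply/eqP; rewrite eq_le r0.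
rewrite -leNgt => r1'; rewrite oppr0 adde0; congr EFin; apply/eqP.
by rewrite eq_le r1'.
Qed.

End unit_interval.

Section quantile_coupling.
Context {R : realType} (s1 s2 : probability R R).

Definition quantile_pair : measurableTypeR R -> R * R := fun u => (quantile s1 u, quantile s2 u).

Lemma measurable_quantile_pair : measurable_fun [set: measurableTypeR R] quantile_pair.
Proof. by apply: measurable_fun_pair; exact: measurable_quantile. Qed.

HB.instance Definition _ :=
  @isMeasurableFun.Build _ _ _ _ quantile_pair measurable_quantile_pair.

Lemma quantile_coupling : coupling s1 s2 (distribution (@unif01 R) quantile_pair).
Proof.
move=> A mA; rewrite -(distribution_quantile s1 mA) -(distribution_quantile s2 mA).
rewrite /distribution /pushforward.
by split; congr (unif01 _); apply/seteqP; split => u /=; rewrite /quantile_pair/=; tauto.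
Qed.

Lemma transport_cost_le_quantile :
  transport_cost (fun x y : R => `|x - y|%R) s1 s2 <=
  \int[@unif01 R]_u (`|quantile s1 u - quantile s2 u|%R)%:E.
Proof.
apply: ereal_inf_lbound; exists (distribution (@unif01 R) quantile_pair).
  exact: quantile_coupling.
rewrite ge0_integral_distribution//.
apply/measurable_EFinP; apply: measurableT_comp => //.
by apply: measurable_funB; [exact: measurable_fst|exact: measurable_snd].
Qed.

End quantile_coupling.

(** * Kantorovich potentials on the real line *)

Section potential.
Local Open Scope ring_scope.
Context {R : realType} (s1 s2 : probability R R).
Implicit Types (x y : R) (n : nat).
Notation leb := (@lebesgue_measure R).

Definition below : set (measurableTypeR R) :=
  [set t : R | (s1 `]-oo, t]%classic < s2 `]-oo, t]%classic)%E].

Lemma measurable_below : measurable below.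
Proof.
have mF (s : probability R R) :
    measurable_fun [set: R] (fun t : R => fine (s `]-oo, t]%classic)).
  apply: nondecreasing_measurable => // a b ab.
  by rewrite fine_le ?fin_num_measure// le_measure ?inE//; exact: subitvPr.
have mt : measurable [set true] by [].
have := measurable_fun_ltr (mF s1) (mF s2) measurableT mt.
rewrite setTI; congr (measurable _); apply/seteqP; split => t /=;
  by rewrite -lte_fin !fineK ?fin_num_measure// => ->.
Qed.

Definition mass_upto n (D : set (measurableTypeR R)) x : R :=
  fine (leb (D `&` (`[- n%:R, n%:R]%classic `&` `]-oo, x[%classic))).

Let mI n (D : set (measurableTypeR R)) (A : set (measurableTypeR R)) :
  measurable D -> measurable A -> measurable (D `&` (`[- n%:R, n%:R]%classic `&` A)).
Proof. by move=> mD mA; apply: measurableI => //; exact: measurableI. Qed.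

Let lebn n : leb `[- n%:R, n%:R]%classic = (2 * n%:R)%:E.
Proof.
rewrite lebesgue_measure_itv/= lte_fin.
case: ltP => h; first by rewrite -EFinD; congr EFin; lra.
by congr EFin; have : 0 <= n%:R :> R by []; lra.
Qed.

Let leb_fin n (D A : set (measurableTypeR R)) : measurable D -> measurable A ->
  (leb (D `&` (`[(- n%:R)%R, (n%:R)%R]%classic `&` A)) <= (2 * n%:R)%R%:E)%E.
Proof.
move=> mD mA; rewrite -lebn le_measure ?inE//; first exact: mI.
by move=> t [_ []].
Qed.

Let leb_fin_num n (D A : set (measurableTypeR R)) : measurable D -> measurable A ->
  leb (D `&` (`[- n%:R, n%:R]%classic `&` A)) \is a fin_num.
Proof.
by move=> mD mA; rewrite ge0_fin_numE// (le_lt_trans (leb_fin _ _ _)) ?ltry.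
Qed.

Lemma mass_upto_bound n D x : measurable D -> 0 <= mass_upto n D x <= 2 * n%:R.
Proof.
move=> mD; rewrite /mass_upto fine_ge0//=.
by rewrite -lee_fin fineK ?leb_fin_num// leb_fin.
Qed.

Lemma mass_uptoB n D x y : measurable D -> x <= y ->
  mass_upto n D y - mass_upto n D x =
  fine (leb (D `&` (`[- n%:R, n%:R]%classic `&` `[x, y[%classic))).
Proof.
move=> mD xy; rewrite /mass_upto.
have -> : D `&` (`[- n%:R, n%:R]%classic `&` `]-oo, y[%classic) =
   (D `&` (`[- n%:R, n%:R]%classic `&` `]-oo, x[%classic)) `|`
   (D `&` (`[- n%:R, n%:R]%classic `&` `[x, y[%classic)).
  apply/seteqP; split => t /=; rewrite !in_itv/=.
    move=> [Dt [nt ty]]; have [tx|xt] := ltP t x; [by left|right].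
    by rewrite ty.
  by case=> [[Dt [nt tx]]|[Dt [nt /andP[_ ty]]]]; split => //; split => //; lra.
rewrite measureU//; [|exact: mI|exact: mI|].
  by rewrite fineD ?leb_fin_num//; ring.
apply/seteqP; split => t //= [[_ [_]]] + [_ [_]].
by rewrite !in_itv/=; lra.
Qed.

Lemma mass_upto_nd n D : measurable D -> {homo mass_upto n D : x y / x <= y}.
Proof.
by move=> mD x y xy; rewrite -subr_ge0 mass_uptoB// fine_ge0.
Qed.

(** With F1, F2 the distribution functions of s1, s2: the slope is 1 where F1 < F2,
    -1 elsewhere in [-n, n], and 0 outside. The constant makes it nonnegative. *)
Definition potential n x : R :=
  mass_upto n below x - mass_upto n (~` below) x + 2 * n%:R.

Let mB := measurable_below.
Let mC : measurable (~` below) := measurableC measurable_below.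

Lemma measurable_potential n : measurable_fun [set: R] (potential n).
Proof.
apply: measurable_funD => //; apply: measurable_funB;
  by apply: nondecreasing_measurable => //; exact: mass_upto_nd.
Qed.

Lemma potential_bound n x : 0 <= potential n x <= 4 * n%:R.
Proof.
have := mass_upto_bound n x mB; have := mass_upto_bound n x mC.
by rewrite /potential; lra.
Qed.

Let mass_split n x y : x <= y ->
  fine (leb (below `&` (`[- n%:R, n%:R]%classic `&` `[x, y[%classic))) +
  fine (leb (~` below `&` (`[- n%:R, n%:R]%classic `&` `[x, y[%classic))) =
  fine (leb (`[- n%:R, n%:R]%classic `&` `[x, y[%classic)).
Proof.
move=> xy; rewrite -fineD ?leb_fin_num//; congr fine.
rewrite -measureU//; [|exact: mI|exact: mI|].
  by rewrite -setIUl setUCr setTI.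
by apply/seteqP; split => t //= [[+ _] [+ _]].
Qed.

Lemma potential_lip n : lipschitz_with 1 (potential n).
Proof.
move=> x y; rewrite mul1r; wlog xy : x y / x <= y => [h|].
  by have [/h//|/ltW/h] := leP x y; rewrite distrC (distrC x).
rewrite distrC [leRHS]distrC [leRHS]ger0_norm ?subr_ge0//.
have e : potential n y - potential n x =
  (mass_upto n below y - mass_upto n below x) -
  (mass_upto n (~` below) y - mass_upto n (~` below) x).
  by rewrite /potential; ring.
rewrite e !mass_uptoB//.
set a := fine _; set b := fine _.
have a0 : 0 <= a by apply: fine_ge0.
have b0 : 0 <= b by apply: fine_ge0.
have ab : a + b <= y - x.
  rewrite mass_split// -lee_fin fineK; last first.
    by rewrite -[X in leb X]setTI leb_fin_num.
  apply: (@le_trans _ _ (leb `[x, y[%classic)).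
    by apply: le_measure; rewrite ?inE//; exact: measurableI.
  rewrite lebesgue_measure_itv/= lte_fin; case: ltP => // _.
  by rewrite lee_fin subr_ge0.
by rewrite ler_norml; apply/andP; split; lra.
Qed.

Definition gap n x y : R := fine (leb (`[- n%:R, n%:R]%classic `&` `[x, y[%classic)).

(** If q1 u <= t < q2 u then F2 t < u <= F1 t, so the potential has slope -1 all
    the way from q1 u to q2 u; symmetrically if q2 u < q1 u. Hence it increases by
    the full distance of the two quantiles, up to truncation. *)
Lemma potential_quantile n u : 0 < u < 1 ->
  potential n (quantile s1 u) - potential n (quantile s2 u) =
  gap n (Num.min (quantile s1 u) (quantile s2 u)) (Num.max (quantile s1 u) (quantile s2 u)).
Proof.
move=> u01; set q1 := quantile s1 u; set q2 := quantile s2 u.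
have Q1 t : (q1 <= t) = (u%:E <= s1 `]-oo, t]%classic)%E by rewrite quantile_le.
have Q2 t : (q2 <= t) = (u%:E <= s2 `]-oo, t]%classic)%E by rewrite quantile_le.
have e x y : potential n y - potential n x =
  (mass_upto n below y - mass_upto n below x) -
  (mass_upto n (~` below) y - mass_upto n (~` below) x).
  by rewrite /potential; ring.
have [q12|q21] := leP q1 q2; rewrite /gap -mass_split//; last exact: ltW.
  rewrite -[LHS]opprB e !mass_uptoB//.
  have -> : below `&` (`[- n%:R, n%:R]%classic `&` `[q1, q2[%classic) = set0.
    apply/seteqP; split => t //=; rewrite /below/= !in_itv/= => -[h [_ /andP[h1 h2]]].
    move: h1 h2; rewrite Q1 ltNge Q2 => h1 /negP; apply.
    by rewrite (le_trans h1)// ltW.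
  by rewrite measure0/=; ring.
rewrite e !mass_uptoB ?ltW//.
have -> : ~` below `&` (`[- n%:R, n%:R]%classic `&` `[q2, q1[%classic) = set0.
  apply/seteqP; split => t //=; rewrite /below/= !in_itv/= => -[h [_ /andP[h1 h2]]].
  move: h1 h2; rewrite Q2 ltNge Q1 => h1 /negP h2; apply: h.
  by rewrite (lt_le_trans _ h1)// ltNge; exact/negP.
by rewrite measure0/=; ring.
Qed.

Lemma gap_nd x y : {homo (fun n => gap n x y) : n m / (n <= m)%N >-> n <= m}.
Proof.
move=> n m nm; rewrite /gap -[X in leb X]setTI -[X in _ <= fine (leb X)]setTI.
rewrite fine_le ?leb_fin_num// le_measure ?inE//; [exact: mI|exact: mI|].
apply: setIS; apply: setSI => t /=; rewrite !in_itv/=.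
have : n%:R <= m%:R :> R by rewrite ler_nat.
by lra.
Qed.

Lemma gap_cvg x y : x <= y -> gap n x y @[n --> \oo] --> y - x.
Proof.
move=> xy; apply: (@cvg_trans _ ((fun=> y - x) @ \oo)); last exact: cvg_cst.
apply: near_eq_cvg; near=> n; rewrite /gap.
have -> : `[- n%:R, n%:R]%classic `&` `[x, y[%classic = `[x, y[%classic :> set (measurableTypeR R).
  apply/seteqP; split => t //=; first by case.
  have : Num.max `|x| `|y| <= n%:R by near: n; exact: nbhs_infty_ger.
  rewrite ge_max => /andP[]; rewrite !ler_norml => /andP[? _] /andP[_ ?].
  by rewrite !in_itv/= => /andP[? ?]; split; lra.
rewrite lebesgue_measure_itv/= lte_fin; case: ltP => //= yx.
by apply/eqP; rewrite subr_eq0 eq_le yx xy.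
Unshelve. all: end_near. Qed.

End potential.

Section kantorovich.
Context {R : realType} (s1 s2 : probability R R).

Lemma integral_quantile (s : probability R R) (f : R -> R) :
  measurable_fun [set: R] f -> (forall x, (0 <= f x)%R) ->
  \int[@unif01 R]_u (f (quantile s u))%:E = \int[s]_x (f x)%:E.
Proof.
move=> mf f0; transitivity (\int[distribution (@unif01 R) (quantile s)]_x (f x)%:E).
  rewrite ge0_integral_distribution//; first exact/measurable_EFinP.
apply: eq_measure_integral => A mA _; exact: distribution_quantile.
Qed.

Lemma bounded_integrable d (T : measurableType d) (mu : {measure set T -> \bar R})
    (D : set T) (f : T -> R) (C : R) : measurable D -> mu D < +oo ->
  measurable_fun D f -> (forall x, D x -> (0 <= f x <= C)%R) ->
  mu.-integrable D (EFin \o f).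
Proof.
move=> mD muD mf fC; apply: measurable_bounded_integrable => //.
exists C; split; first exact: num_real.
move=> M CM x Dx /=; have /andP[f0 fC'] := fC _ Dx.
by rewrite ger0_norm// (le_trans fC')// ltW.
Qed.

(** Duality on the line: the quantile coupling costs the integral of |q1 - q2|,
    which by [potential_quantile] is the increasing limit of the differences of
    the means of the potentials. *)
Lemma transport_cost_le_potential (K : \bar R) :
  (forall n, \int[s1]_x (potential s1 s2 n x)%:E -
             \int[s2]_x (potential s1 s2 n x)%:E <= K) ->
  transport_cost (fun x y : R => `|x - y|%R) s1 s2 <= K.
Proof.
move=> hK; apply: le_trans (transport_cost_le_quantile s1 s2) _.
pose q1 := quantile s1; pose q2 := quantile s2.
pose J n u := (gap n (Num.min (q1 u) (q2 u)) (Num.max (q1 u) (q2 u)))%:E.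
pose D : set (measurableTypeR R) := `]0%R, 1%R[%classic.
have mD : measurable D by exact: measurable_itv.
have D01 u : D u -> (0 < u < 1)%R by rewrite /D /= in_itv.
have UD (f : measurableTypeR R -> \bar R) : measurable_fun setT f ->
    (forall u, 0 <= f u) ->
    \int[@unif01 R]_u f u = \int[@unif01 R]_(u in D) f u.
  move=> mf f0; rewrite (@ge0_negligible_integral _ _ _ _ setT (~` D))//.
  - by rewrite setTD setCK.
  - exact: measurableC.
  - by change (mrestr (@lebesgue_measure R) mD (~` D) = 0); rewrite /mrestr setICl measure0.
have mq1 : measurable_fun [set: measurableTypeR R] q1 by exact: measurable_quantile.
have mq2 : measurable_fun [set: measurableTypeR R] q2 by exact: measurable_quantile.
have mp n : measurable_fun [set: R] (potential s1 s2 n) by exact: measurable_potential.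
have JE n u : D u -> J n u = (potential s1 s2 n (q1 u))%:E - (potential s1 s2 n (q2 u))%:E.
  by move=> Du; rewrite /J -potential_quantile// ?EFinB//; exact: D01.
have mpq n (q : measurableTypeR R -> R) : measurable_fun setT q ->
    measurable_fun [set: measurableTypeR R] (fun u => (potential s1 s2 n (q u))).
  by move=> mq; apply: measurableT_comp.
have UDoo : @unif01 R D < +oo.
  by rewrite (le_lt_trans (probability_le1 _ _)) ?ltry.
have ip n (q : measurableTypeR R -> R) : measurable_fun setT q ->
    (@unif01 R).-integrable D (EFin \o (fun u => (potential s1 s2 n (q u)))).
  move=> mq; apply: (@bounded_integrable _ _ _ _ _ (4 * n%:R)%R) => //.
    by apply: measurable_funTS; exact: mpq.
  by move=> u _; exact: potential_bound.
have IJ n : \int[@unif01 R]_(u in D) J n u <= K.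
  rewrite (eq_integral (fun u => (potential s1 s2 n (q1 u))%:E - (potential s1 s2 n (q2 u))%:E)); last first.
    by move=> u /set_mem; exact: JE.
  rewrite integralB//; [|exact: ip|exact: ip].
  rewrite -!UD; last 4 first.
  - by apply/measurable_EFinP; exact: mpq.
  - by move=> u; rewrite lee_fin; case/andP: (potential_bound s1 s2 n (q2 u)).
  - by apply/measurable_EFinP; exact: mpq.
  - by move=> u; rewrite lee_fin; case/andP: (potential_bound s1 s2 n (q1 u)).
  have p0 x : (0 <= potential s1 s2 n x)%R by case/andP: (potential_bound s1 s2 n x).
  rewrite (integral_quantile s1 (mp n) p0) (integral_quantile s2 (mp n) p0).
  exact: hK.
have J0 n u : 0 <= J n u by rewrite lee_fin /gap fine_ge0.
have mJ n : measurable_fun D (J n).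
  apply: (@eq_measurable_fun _ _ _ _ _ (fun u => (potential s1 s2 n (q1 u) - potential s1 s2 n (q2 u))%:E)).
    by move=> u /set_mem Du; rewrite JE.
  by apply/measurable_EFinP/measurable_funTS/measurable_funB; exact: mpq.
rewrite UD//; last first.
  by apply/measurable_EFinP; apply: measurableT_comp => //; exact: measurable_funB.
have JL u : limn (J^~ u) = `|q1 u - q2 u|%:E.
  apply: cvg_lim => //; apply: cvg_EFin; first exact: nearW.
  have -> : `|q1 u - q2 u|%R = (Num.max (q1 u) (q2 u) - Num.min (q1 u) (q2 u))%R.
    by case: leP => h; [rewrite ler0_norm ?subr_le0// opprB|rewrite ger0_norm// subr_ge0 ltW].
  by apply: gap_cvg; rewrite ge_min !le_max lexx.
rewrite (eq_integral (fun u => limn (J^~ u))); last by move=> u _; rewrite JL.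
rewrite monotone_convergence//; last first.
  by move=> u _ n m nm; rewrite lee_fin; exact: gap_nd.
apply: lime_le; last exact: nearW.
apply: ereal_nondecreasing_is_cvgn => n m nm.
apply: ge0_le_integral => // u _; rewrite lee_fin; exact: gap_nd.
Qed.

End kantorovich.

(** * Transport-entropy inequalities from Laplace transforms *)

Section gibbs.
Context d (T : measurableType d) (R : realType).

(** Monotonicity that covers an f of infinite integral, such as the logarithm of a
    density. *)
Lemma ge_integrable_integral (mu : {measure set T -> \bar R}) (l f : T -> \bar R) :
  measurable_fun setT f -> mu.-integrable setT l ->
  {ae mu, forall x, l x <= f x} -> \int[mu]_x l x <= \int[mu]_x f x.
Proof.
move=> mf il lf; have ml := measurable_int _ il.
rewrite integralE [leRHS]integralE; apply: leeB.
  apply: ae_ge0_le_integral => //.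
  - exact: measurable_funepos.
  - exact: measurable_funepos.
  - by apply: filterS lf => x lfx _; rewrite !funeposE ge_max le_max lfx /= le_max lexx orbT.
apply: ae_ge0_le_integral => //.
- exact: measurable_funeneg.
- exact: measurable_funeneg.
- by apply: filterS lf => x lfx _; rewrite !funenegE ge_max !le_max leeN2 lfx /= lexx orbT.
Qed.

(** Let b be the density and w := e^(f - K) / b. Then ln b = f - K - ln w is at
    least f - K + 1 - w, and the integral of w under s is at most that of
    e^(f - K) under m, hence at most 1. *)
Lemma gibbs (s m : probability T R) (f : T -> R) (C K : R) : s `<< m ->
  measurable_fun [set: T] f -> (forall x, (0 <= f x <= C)%R) ->
  \int[m]_x (expR (f x))%:E <= (expR K)%:E ->
  \int[s]_x (f x)%:E - K%:E <=
  \int[s]_x lne (Radon_Nikodym (charge_of_finite_measure s) m x).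
Proof.
move=> sm mf fC hK.
(* [r] is the density in the entropy, [r0] a nonnegative version of it. *)
set r := Radon_Nikodym _ _.
pose r0 := Radon_Nikodym_SigmaFinite.f s m.
pose b x := fine (r0 x).
have r00 x : 0 <= r0 x by exact: Radon_Nikodym_SigmaFinite.f_ge0.
have r0E x : r0 x = (b x)%:E by rewrite fineK// Radon_Nikodym_SigmaFinite.f_fin_num.
have b0 x : (0 <= b x)%R by rewrite fine_ge0.
have mr0 : measurable_fun setT r0.
  by apply: (measurable_int m); exact: Radon_Nikodym_SigmaFinite.f_integrable.
have mb : measurable_fun setT b by exact: measurableT_comp.
pose w x := expR (f x - K - ln (b x)).
have mw : measurable_fun setT w.
  apply: measurableT_comp => //; apply: measurable_funB.
    exact: measurable_funB.
  by apply: measurableT_comp => //; exact: measurable_ln.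
have wint : \int[s]_x (w x)%:E <= 1.
  rewrite -(Radon_Nikodym_SigmaFinite.change_of_variables sm)//; last 2 first.
  - by move=> x; rewrite lee_fin expR_ge0.
  - exact/measurable_EFinP.
  apply: (@le_trans _ _ (\int[m]_x ((expR (- K))%:E * (expR (f x))%:E))).
    apply: ge0_le_integral => //.
    - by move=> x _; rewrite mule_ge0// lee_fin expR_ge0.
    - by apply: emeasurable_funM => //; exact/measurable_EFinP.
    - by apply: emeasurable_funM => //; apply/measurable_EFinP; exact: measurableT_comp.
    - move=> x _; rewrite -/r0 r0E -!EFinM lee_fin.
      have [bx0|bx0] := eqVneq (b x) 0%R; first by rewrite bx0 mulr0 mulr_ge0// expR_ge0.
      have bp : (0 < b x)%R by rewrite lt_def bx0 b0.
      rewrite /w expRB lnK// divfK// ?gt_eqF//.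
      by rewrite -expRD addrC.
  rewrite ge0_integralZl//; last by apply/measurable_EFinP; exact: measurableT_comp.
  apply: (@le_trans _ _ ((expR (- K))%:E * (expR K)%:E)).
    by rewrite lee_wpmul2l// lee_fin expR_ge0.
  by rewrite -EFinM -expRD addNr expR0.
have iw : s.-integrable setT (EFin \o w).
  apply/integrableP; split; first exact/measurable_EFinP.
  rewrite (eq_integral (EFin \o w)).
    by rewrite (le_lt_trans wint)// ltry.
  by move=> x _; rewrite gee0_abs// lee_fin expR_ge0.
have if_ : s.-integrable setT (EFin \o f).
  apply: (@bounded_integrable _ _ _ _ _ _ C) => //.
  by rewrite (le_lt_trans (probability_le1 _ _)) ?ltry.
have ic (c : R) : s.-integrable setT (EFin \o cst c) by exact: finite_measure_integrable_cst.
pose l x := (EFin \o f \+ (EFin \o cst (1 - K)%R)) x - (EFin \o w) x.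
have ifc : s.-integrable setT (EFin \o f \+ (EFin \o cst (1 - K)%R)) by exact: integrableD.
have il : s.-integrable setT l by exact: integrableB.
have le1 : \int[s]_x (f x)%:E - K%:E <= \int[s]_x l x.
  rewrite /l integralB// integralD//=.
  have -> : \int[s]_x (1 - K)%:E = (1 - K)%:E.
    have := @integral_cst _ _ _ s setT measurableT (1 - K)%:E.
    by rewrite /cst => ->; rewrite -[RHS]mule1; congr (_ * _); exact: probability_setT.
  have fIf : \int[s]_x (f x)%:E \is a fin_num by exact: (integrable_fin_num measurableT if_).
  have fIw : \int[s]_x (w x)%:E \is a fin_num by exact: (integrable_fin_num measurableT iw).
  move: wint; rewrite -(fineK fIf) -(fineK fIw) lee_fin => wi.
  by rewrite -EFinN -!EFinD lee_fin; lra.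
apply: le_trans le1 _; apply: ge_integrable_integral => //.
  have rf x : r x \is a fin_num by exact: Radon_Nikodym_fin_num.
  have mr : measurable_fun setT r.
    by apply: (measurable_int m); exact: Radon_Nikodym_integrable.
  apply: (@eq_measurable_fun _ _ _ _ _
    (fun x => if (0 < fine (r x))%R then (ln (fine (r x)))%:E else -oo)).
    move=> x _; rewrite -[in RHS](fineK (rf x)); case: ifPn => [r_gt0|].
      by rewrite lne_EFin.
    by rewrite -leNgt => rn; rewrite le0_lneNy.
  have mfr : measurable_fun setT (fun x => fine (r x)) by exact: measurableT_comp.
  apply: measurable_fun_if => //.
    by apply: measurable_fun_ltr => //; exact: measurable_cst.
  apply/measurable_EFinP; apply: measurable_funTS.
  by apply: measurableT_comp => //; exact: measurable_ln.
(* The density vanishes only on an s-null set, so its logarithm is finite. *)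
have bpos : {ae s, forall x, (0 < b x)%R}.
  have mb0 : measurable [set x | b x = 0%R].
    have m0 : measurable [set 0%R : R] by exact: measurable_set1.
    by have := mb measurableT _ m0; rewrite setTI.
  exists [set x | b x = 0%R]; split => //.
    rewrite (Radon_Nikodym_SigmaFinite.f_integral sm)//.
    by apply: integral0_eq => x /= bx0; rewrite -/r0 r0E bx0.
  by move=> x /= /negP; rewrite -leNgt => bx; apply/eqP; rewrite eq_le bx b0.
have rr0 : ae_eq s setT r0 r.
  apply: (null_dominates_ae_eq measurableT sm).
  exact: ae_eq_Radon_Nikodym_SigmaFinite.
apply: filterS2 bpos rr0 => x bx /(_ I) <-.
rewrite r0E lne_EFin//.
change ((f x + (1 - K) - w x)%:E <= (ln (b x))%:E); rewrite lee_fin /w.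
have := @expR_ge1Dx R (f x - K - ln (b x)); lra.
Qed.

End gibbs.

Section bobkov_goetze.
Context {R : realType} (s m : probability R R).

(** [gibbs] for the function th f bounds th times a difference of means by H + L;
    the potentials are admissible f, and their differences of means reach the
    transport cost. *)
Theorem transport_entropy_of_laplace (th L : R) : (0 <= th)%R ->
  (forall (f : R -> R) (C : R), measurable_fun [set: R] f ->
     (forall x, (0 <= f x <= C)%R) -> lipschitz_with 1 f ->
     \int[m]_x (expR (th * f x))%:E <=
     (expR (th * fine (\int[m]_x (f x)%:E) + L))%:E) ->
  th%:E * transport_cost (fun x y : R => `|x - y|%R) s m - L%:E <=
  relative_entropy s m.
Proof.
move=> th0 laplace; rewrite /relative_entropy; case: ifPn => [/asboolP sm|_]; last first.
  by rewrite leey.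
set H := \int[s]_x _.
have key (f : R -> R) (C : R) : measurable_fun [set: R] f ->
     (forall x, (0 <= f x <= C)%R) -> lipschitz_with 1 f ->
     th%:E * (\int[s]_x (f x)%:E - \int[m]_x (f x)%:E) - L%:E <= H.
  move=> mf fC fL.
  have fin (p : probability R R) : \int[p]_x (f x)%:E \is a fin_num.
    apply: integrable_fin_num => //; apply: (@bounded_integrable R _ _ _ _ _ C) => //.
    by rewrite (le_lt_trans (probability_le1 _ _)) ?ltry.
  have thfC x : (0 <= th * f x <= th * C)%R.
    by have /andP[f0 fC'] := fC x; rewrite mulr_ge0// ler_wpM2l.
  have mthf : measurable_fun [set: R] (fun x => th * f x)%R.
    by apply: measurable_funM => //; exact: measurable_cst.
  have := gibbs sm mthf thfC (laplace f C mf fC fL).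
  apply: le_trans.
  have -> : \int[s]_x (th * f x)%:E = th%:E * \int[s]_x (f x)%:E.
    rewrite -ge0_integralZl//; first exact/measurable_EFinP.
    by move=> x _; rewrite lee_fin; case/andP: (fC x).
  rewrite -(fineK (fin s)) -(fineK (fin m)) -EFinB -!EFinM -!EFinB lee_fin /=.
  by lra.
(* For th = 0 the claim is - L <= H, which the test function 0 gives. *)
have [->|thN0] := eqVneq th 0%R.
  have c0 (p : probability R R) : \int[p]_x (cst 0%R x)%:E = 0 by exact: integral0.
  have := @key (cst 0%R) 0%R; rewrite !c0 subee// mule0 mul0e; apply => //.
    by move=> x; rewrite /= lexx.
  by move=> x y; rewrite /= subrr normr0 mul1r.
have th_gt0 : (0 < th)%R by rewrite lt_def thN0.
have [->|Hoo] := eqVneq H +oo; first exact: leey.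
pose K := (H + L%:E) * (th^-1)%:E.
have tK n : \int[s]_x (potential s m n x)%:E - \int[m]_x (potential s m n x)%:E <= K.
  have := key _ _ (measurable_potential s m n) (potential_bound s m n) (potential_lip s m n).
  by rewrite leeBlDr// => h; rewrite /K lee_pdivlMr// muleC.
have := transport_cost_le_potential tK.
by rewrite /K lee_pdivlMr// muleC leeBlDr.
Qed.

End bobkov_goetze.

(** * Joint law of the counts of a Cox process *)

Section cox_simple.
Context d (Omega : measurableType d) (R : realType) (P : probability Omega R).
Context dZ (Z : measurableType dZ) (mu : {sigma_finite_measure set Z -> \bar R}).
Variables (D : set Z) (mD : measurable D) (lambda : Z -> Omega -> R).
Variable N : R.-ker Omega ~> Z.
Hypothesis mlambda : measurable_fun (D `*` [set: Omega])
  (fun p : Z * Omega => lambda p.1 p.2).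
Hypothesis lambda_ge0 : forall z w, D z -> (0 <= lambda z w)%R.
Hypothesis coxN : conditionally_poisson P mu D lambda N.
Hypothesis lambda_fin : {ae P, forall w, \int[mu]_(z in D) (lambda z w)%:E < +oo}.

Definition mean (B : set Z) (w : Omega) : \bar R := \int[mu]_(z in B) (lambda z w)%:E.

Lemma mean_ge0 B w : B `<=` D -> 0 <= mean B w.
Proof. by move=> BD; apply: integral_ge0 => z /BD Dz; rewrite lee_fin lambda_ge0. Qed.

Lemma measurable_lambda1 B w : measurable B -> B `<=` D ->
  measurable_fun B (fun z => lambda z w).
Proof.
move=> mB BD; apply: (measurable_funS mD BD).
apply: (measurable_comp (measurableX mD measurableT) _ mlambda (g := fun z => (z, w))).
  by move=> _ [z Dz <-].
apply: measurable_funTS; apply: measurable_fun_pair => //; exact: measurable_cst.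
Qed.

Lemma measurable_mean B : measurable B -> B `<=` D -> measurable_fun setT (mean B).
Proof.
move=> mB BD.
pose f : Z * Omega -> \bar R := (fun p => (lambda p.1 p.2)%:E) \_ (B `*` [set: Omega]).
have mf : measurable_fun setT f.
  apply/(measurable_restrictT _ _).1; first exact: measurableX.
  apply/measurable_EFinP; apply: measurable_funS mlambda => //.
    exact: measurableX.
  by move=> p [Bp _]; split => //; exact: BD.
have f0 p : 0 <= f p.
  rewrite /f patchE; case: ifPn => // /set_mem[Bp _].
  by rewrite lee_fin lambda_ge0//; exact: BD.
have := @measurable_fun_fubini_tonelli_G _ _ _ _ _ mu f mf f0.
congr (measurable_fun _ _); apply/funext => w.
rewrite /fubini_G /mean [RHS]integral_mkcond; apply: eq_integral => z _.
rewrite /f !patchE; congr (if _ then _ else _).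
by apply/idP/idP => /set_mem h; apply/mem_set => //; case: h.
Qed.

Lemma mean_fin B w : measurable B -> B `<=` D ->
  \int[mu]_(z in D) (lambda z w)%:E < +oo -> mean B w \is a fin_num.
Proof.
move=> mB BD fin; rewrite ge0_fin_numE ?mean_ge0//; apply: le_lt_trans fin.
apply: ge0_subset_integral => //.
  by apply/measurable_EFinP; exact: measurable_lambda1.
by move=> z Dz; rewrite lee_fin lambda_ge0.
Qed.

Variables (n : nat) (A : nat -> set Z).
Hypothesis mA : forall i, measurable (A i).
Hypothesis AD : forall i, A i `<=` D.
Hypothesis tA : trivIset setT A.

Definition rate w i : R := fine (mean (A i) w).

Lemma rate_ge0 w i : (0 <= rate w i)%R.
Proof. by rewrite fine_ge0// mean_ge0. Qed.

Lemma measurable_rate i : measurable_fun setT (rate^~ i).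
Proof. by apply: measurableT_comp => //; exact: measurable_mean. Qed.

Lemma measurable_pois k : measurable_fun [set: R] (fun m : R => pois m k).
Proof.
apply: measurable_funM.
  by apply: measurable_funM => //; exact: measurable_funX.
by apply: measurableT_comp => //; apply: measurableT_comp.
Qed.

Lemma poisson_massE (r : R) k : (0 <= r)%R -> poisson_mass r%:E k = (pois r k)%:E.
Proof.
move=> r0; rewrite /poisson_mass /poisson_prob /pois /exp_coeff /=.
case: ifPn => [rp|].
  by rewrite esum_set1 ?lee_fin ?poisson_pmf_ge0// /poisson_pmf rp.
(* A Poisson variable of mean 0 is 0. *)
rewrite -leNgt => r0'; have -> : r = 0%R by apply/eqP; rewrite eq_le r0' r0.
rewrite diracE oppr0 expR0 mulr1.
case: k => [|k]; first by rewrite expr0 fact0 divr1 mem_set.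
by rewrite memNset//= expr0n mul0r.
Qed.

Lemma sum_pois (r : R) : (0 <= r)%R -> \sum_(0 <= k <oo) (pois r k)%:E = 1.
Proof.
move=> r0; have u1 (k : nat) : (0 <= (fun=> 1%R : R) k <= 1)%R by rewrite ler01 lexx.
have [cv e] := pavg_series r0 u1.
transitivity ((pavg r (fun=> 1%R))%:E).
  by rewrite -e; apply: eq_eseriesr => k _; rewrite mulr1.
congr EFin; apply: cvg_lim => //.
by under eq_fun do rewrite iter_bern_cst; exact: cvg_cst.
Qed.

Lemma measurable_poisson_mass B k : measurable B -> B `<=` D ->
  measurable_fun setT (fun w => poisson_mass (mean B w) k).
Proof.
move=> mB BD; apply: (eq_measurable_fun (fun w =>
  if mean B w < +oo then (pois (fine (mean B w)) k)%:E else 0)).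
  move=> w _; have m0 := mean_ge0 w BD; case: ifPn => [fin|].
    have f : mean B w \is a fin_num by rewrite ge0_fin_numE.
    by rewrite -[in RHS](fineK f) poisson_massE// fine_ge0.
  by rewrite -leNgt leye_eq => /eqP ->.
apply: measurable_fun_ifT.
- by apply: measurable_fun_lte; [exact: measurable_mean|exact: measurable_cst].
- apply/measurable_EFinP; apply: (measurableT_comp (@measurable_pois k)).
  by apply: measurableT_comp => //; exact: measurable_mean.
- exact: measurable_cst.
Qed.

Lemma measurable_pois_rate i k : measurable_fun setT (fun w => (pois (rate w i) k)%:E).
Proof.
by apply/measurable_EFinP; apply: (measurableT_comp (@measurable_pois k)); exact: measurable_rate.
Qed.

Lemma emeasurable_prod (s : seq nat) (f : nat -> Omega -> \bar R) :
  (forall i, measurable_fun setT (f i)) ->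
  measurable_fun setT (fun w => \prod_(i <- s) f i w).
Proof.
move=> mf; elim: s => [|i s IH].
  by under eq_fun do rewrite big_nil; exact: measurable_cst.
by under eq_fun do rewrite big_cons; exact: emeasurable_funM.
Qed.

(** The conditional law of the counts, tested against the sure event. *)
Lemma law_counts (k : nat -> nat) :
  P [set w | forall i, (i < n)%N -> N w (A i) = (k i)%:R%:E] =
  \int[P]_w \prod_(0 <= i < n) (pois (rate w i) (k i))%:E.
Proof.
have S0 : intensity_sigma_algebra D lambda [set: Omega].
  case: (@smallest_sigma_algebra _ setT (\bigcup_(z in D) preimage_set_system setT (lambda z) measurable)) => h0 hC _.
  by have := hC _ h0; rewrite setD0.
have := @coxN n (fun i => A i) (fun i => k i) setT (fun i => mA i) (fun i => @AD i) _ S0.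
rewrite setTI => e; transitivity (P [set w | forall i : 'I_n, N w (A i) = (k i)%:R%:E]).
  congr (P _); apply/seteqP; split => w /= h i; first exact: h.
  by move=> ni; have := h (Ordinal ni).
rewrite e; last first.
  move=> i j _ _ Aij; apply: val_inj => /=; exact: (@tA i j).
apply: ge0_ae_eq_integral => //.
- rewrite (_ : (fun w => _) = (fun w => \prod_(0 <= i < n) poisson_mass (mean (A i) w) (k i))).
    by apply: emeasurable_prod => i; exact: measurable_poisson_mass.
  by apply/funext => w; rewrite big_mkord.
- by apply: emeasurable_prod => i; exact: measurable_pois_rate.
- move=> w _; apply: prode_ge0 => i _; rewrite /poisson_mass.
  by case: integral => // r; exact: measure_ge0.
- by move=> w _; apply: prode_ge0 => i _; rewrite lee_fin pois_ge0// rate_ge0.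
- apply: filterS lambda_fin => w fin _; rewrite big_mkord; apply: eq_bigr => i _.
  have f := mean_fin (mA i) (@AD i) fin.
  by rewrite -[X in poisson_mass X](fineK f) poisson_massE// rate_ge0.
Qed.

End cox_simple.


Section cox_compound.
Context d (Omega : measurableType d) (R : realType) (P : probability Omega R).
Context dZ (Z : measurableType dZ) (mu : {sigma_finite_measure set Z -> \bar R}).
Variables (D : set Z) (mD : measurable D) (lambda : Z -> Omega -> R).
Variable N : R.-ker Omega ~> Z.
Hypothesis mlambda : measurable_fun (D `*` [set: Omega])
  (fun p : Z * Omega => lambda p.1 p.2).
Hypothesis lambda_ge0 : forall z w, D z -> (0 <= lambda z w)%R.
Hypothesis coxN : conditionally_poisson P mu D lambda N.
Hypothesis lambda_fin : {ae P, forall w, \int[mu]_(z in D) (lambda z w)%:E < +oo}.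

Let count_eq (A : set Z) (v : nat) : set Omega := [set w | N w A = v%:R%:E].

Let measurable_count_eq A v : measurable A -> measurable (count_eq A v).
Proof.
move=> mA; have := measurable_kernel N A mA measurableT.
by move=> /(_ _ (emeasurable_set1 v%:R%:E)); rewrite setTI.
Qed.

Let trivIset_count_eq A : trivIset setT (count_eq A).
Proof.
move=> i j _ _ [w [/= h1 h2]]; apply/eqP.
by rewrite -(eqr_nat R) -eqe -h1 -h2.
Qed.

(** The probabilities of the finite integer values already add up to 1. *)
Lemma ae_count_nat A : measurable A -> A `<=` D ->
  {ae P, forall w, exists v : nat, N w A = v%:R%:E}.
Proof.
move=> mA AD.
pose A' i := if i is 0%N then A else set0.
have mA' i : measurable (A' i) by case: i => [|i] //=; exact: measurable0.
have AD' i : A' i `<=` D by case: i => [|i] //=; exact: sub0set.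
have tA' : trivIset setT A'.
  by move=> [|i] [|j] _ _ [z [h1 h2]].
have pe v : P (count_eq A v) = \int[P]_w (pois (rate mu lambda A' w 0) v)%:E.
  have := law_counts mD mlambda lambda_ge0 coxN lambda_fin 1 mA' AD' tA' (fun=> v).
  under eq_integral do rewrite big_nat1.
  move=> <-; congr (P _); apply/seteqP; split => w /=.
    by move=> h [|i].
  by move=> /(_ 0%N erefl).
have mU : measurable (\bigcup_v count_eq A v).
  by apply: bigcup_measurable => v _; exact: measurable_count_eq.
exists (~` \bigcup_v count_eq A v); split.
- exact: measurableC.
- transitivity (1 - \sum_(0 <= v <oo) \int[P]_w (pois (rate mu lambda A' w 0) v)%:E).
    rewrite probability_setC//; congr (_ - _); rewrite measure_bigcup//; last first.
      by move=> i _; exact: measurable_count_eq.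
    rewrite (eq_eseriesl (Q := predT)); last by move=> i; rewrite in_setT.
    by apply: eq_eseriesr => v _; exact: pe.
  rewrite -integral_nneseries//; last 2 first.
  - by move=> v; exact: (@measurable_pois_rate _ _ _ _ _ mu D mD lambda mlambda lambda_ge0 A' mA' AD').
  - by move=> v w _; rewrite lee_fin pois_ge0// (rate_ge0 mu lambda_ge0 AD').
  under eq_integral do rewrite sum_pois ?(rate_ge0 mu lambda_ge0 AD')//.
  have := @integral_cst _ _ _ P setT measurableT 1; rewrite /cst => ->.
  rewrite mul1e; apply: (etrans (congr1 (fun x => 1 - x) (probability_setT P))).
  exact: subee.
- by move=> w /= h [v _ hv]; apply: h; exists v.
Qed.

Variable A : nat -> set Z.
Hypothesis mA : forall i, measurable (A i).
Hypothesis AD : forall i, A i `<=` D.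
Hypothesis tA : trivIset setT A.
Variable c : nat -> R.

Definition count w i : R := fine (N w (A i)).

Let rate w i := rate mu lambda A w i.
Let rate0 w i : (0 <= rate w i)%R.
Proof. exact: (rate_ge0 mu lambda_ge0 AD). Qed.

Lemma measurable_count i : measurable_fun setT (count^~ i).
Proof. by apply: measurableT_comp => //; exact: measurable_kernel. Qed.

Lemma measurable_compound (F : R -> R) C j : (forall x, (0 <= F x <= C)%R) ->
  forall x, measurable_fun setT (fun w => compound j (rate w) c F x).
Proof.
move=> FC; elim: j => [|j IH] x; first exact: measurable_cst.
apply/measurable_EFinP.
rewrite (_ : _ \o _ = (fun w => \sum_(0 <= k <oo)
   (pois (rate w j) k * compound j (rate w) c F (x + c j * k%:R))%:E)); last first.
  apply/funext => w /=.
  have bd k : (0 <= compound j (rate w) c F (x + c j * k%:R)%R <= C)%R.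
    exact: compound_bound.
  by have [_ ->] := pavg_series (rate0 w j) bd.
apply: (ge0_emeasurable_sum (P := predT)) => [k w _ _|k _].
  rewrite lee_fin mulr_ge0 ?pois_ge0//.
  by have /andP[] := compound_bound j c (rate0 w) FC (x + c j * k%:R)%R.
apply/measurable_EFinP; apply: measurable_funM => //.
apply/measurable_EFinP; exact: (@measurable_pois_rate _ _ _ _ _ mu D mD lambda mlambda lambda_ge0 A mA AD).
Qed.

Variable n : nat.

Let tail_event j (k : nat -> nat) : set Omega :=
  [set w | forall i, (j <= i < n)%N -> N w (A i) = (k i)%:R%:E].

Let measurable_tail j k : measurable (tail_event j k).
Proof.
rewrite (_ : tail_event j k = \bigcap_i (if (j <= i < n)%N then count_eq (A i) (k i) else setT)).
  apply: bigcap_measurable => // i _; case: ifPn => // _; exact: measurable_count_eq.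
apply/seteqP; split => w /= h i.
  by move=> _; case: ifPn => // ij; exact: h.
by move=> ij; have := h i I; rewrite ij.
Qed.

(** The counts 0, ..., j - 1 have been integrated out and the counts j, ..., n - 1
    are still prescribed by k. Passing from j to j + 1 sums over the value of count
    j, which turns one Poisson factor into one more average in [compound]. *)
Let step (F : R -> R) C j k x : (forall x, (0 <= F x <= C)%R) -> measurable_fun setT F ->
  (j <= n)%N ->
  \int[P]_(w in tail_event j k) (F (x + \sum_(i < j) c i * count w i)%R)%:E =
  \int[P]_w (compound j (rate w) c F x * \prod_(j <= i < n) pois (rate w i) (k i))%:E.
Proof.
move=> FC mF.
have F0 y : (0 <= F y)%R by case/andP: (FC y).
have mS j' x' : measurable_fun setT (fun w => (F (x' + \sum_(i < j') c i * count w i)%R)%:E).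
  apply/measurable_EFinP; apply: (measurableT_comp mF).
  apply: measurable_funD; first exact: measurable_cst.
  apply: measurable_sum => i; apply: measurable_funM; first exact: measurable_cst.
  exact: measurable_count.
elim: j k x => [|j IH] k x jn.
  rewrite /= (eq_integral (cst (F x)%:E)); last by move=> w _; rewrite big_ord0 addr0.
  rewrite integral_cst//.
  have e : tail_event 0 k = [set w | forall i, (i < n)%N -> N w (A i) = (k i)%:R%:E].
    by apply/seteqP; split.
  transitivity ((F x)%:E * \int[P]_w \prod_(0 <= i < n) (pois (rate w i) (k i))%:E).
    congr (_ * _); rewrite e.
    exact: (law_counts mD mlambda lambda_ge0 coxN lambda_fin n mA AD tA k).
  rewrite -ge0_integralZl//.
  - by apply: eq_integral => w _; rewrite EFinM prodEFin.
  - by apply: emeasurable_prod => i; exact: (@measurable_pois_rate _ _ _ _ _ mu D mD lambda mlambda lambda_ge0 A mA AD).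
  - by move=> w _; apply: prode_ge0 => i _; rewrite lee_fin pois_ge0.
  - by rewrite lee_fin.
pose k' v := fun i => if i == j then v else k i.
have split_tail v : tail_event j (k' v) = tail_event j.+1 k `&` count_eq (A j) v.
  apply/seteqP; split => w /=.
    move=> h; split.
      move=> i /andP[ji ni]; have := h i; rewrite (ltnW ji) ni => /(_ isT).
      by rewrite /k' gtn_eqF.
    by have := h j; rewrite leqnn jn /k' eqxx; exact.
  move=> [h1 h2] i /andP[ji ni]; rewrite /k'; have [->//|ij] := eqVneq i j.
  by apply: h1; rewrite ltn_neqAle eq_sym ij ji.
have prodE v w : (\prod_(j <= i < n) pois (rate w i) (k' v i) =
    pois (rate w j) v * \prod_(j.+1 <= i < n) pois (rate w i) (k i))%R.
  rewrite big_ltn// /k' eqxx; congr (_ * _)%R; apply: eq_big_nat => i /andP[ji _].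
  by rewrite gtn_eqF.
pose U := \bigcup_v tail_event j (k' v).
have mU : measurable U by apply: bigcup_measurable => v _; exact: measurable_tail.
have US : U `<=` tail_event j.+1 k by move=> w [v _]; rewrite split_tail => -[].
(* Off a null set count j is an integer, so U exhausts the event. *)
transitivity (\int[P]_(w in U) (F (x + \sum_(i < j.+1) c i * count w i)%R)%:E).
  have [S [mS' PS Ssub]] := ae_count_nat (mA j) (@AD j).
  have F0' w : 0 <= (F (x + \sum_(i < j.+1) c i * count w i)%R)%:E by rewrite lee_fin.
  rewrite (ge0_negligible_integral mS' (measurable_tail j.+1 k) _ (fun w _ => F0' w) PS); last first.
    by apply: measurable_funTS; exact: mS.
  rewrite [RHS](ge0_negligible_integral mS' mU _ (fun w _ => F0' w) PS); last first.
    by apply: measurable_funTS; exact: mS.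
  congr (integral _ _ _); apply/seteqP; split => w [Uw nSw]; split => //; last exact: US.
  have : exists v : nat, N w (A j) = v%:R%:E.
    by apply: contrapT => h; apply: nSw; exact: Ssub.
  by case=> v hv; exists v => //; rewrite split_tail.
rewrite ge0_integral_bigcup; last 4 first.
- by move=> v; exact: measurable_tail.
- by apply: measurable_funTS; exact: mS.
- by move=> w _; rewrite lee_fin.
- move=> u v _ _ [w []]; rewrite !split_tail => -[_ hu] [_ hv].
  by apply: (@trivIset_count_eq (A j) u v) => //; exists w.
transitivity (\sum_(0 <= v <oo) \int[P]_w (compound j (rate w) c F (x + c j * v%:R) *
    (pois (rate w j) v * \prod_(j.+1 <= i < n) pois (rate w i) (k i)))%:E).
  apply: eq_eseriesr => v _.
  under [RHS]eq_integral do rewrite -prodE.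
  rewrite -IH ?(ltnW jn)//; apply: eq_integral => w /set_mem.
  rewrite split_tail => -[_ hw]; congr (F _)%:E.
  rewrite big_ord_recr/= addrA addrAC; congr (_ + _ * _ + _)%R.
  by rewrite /count hw.
rewrite -integral_nneseries//.
- apply: eq_integral => w _.
  have bd v : (0 <= compound j (rate w) c F (x + c j * v%:R)%R <= C)%R.
    exact: compound_bound.
  have [_ e] := pavg_series (rate0 w j) bd.
  rewrite [in RHS]EFinM /= /jumpavg -e muleC -nneseriesZl//.
    by apply: eq_eseriesr => v _; rewrite -EFinM; congr EFin; ring.
  by move=> v _; rewrite lee_fin mulr_ge0 ?pois_ge0//; case/andP: (bd v).
- move=> v; apply/measurable_EFinP; apply: measurable_funM; first exact: (measurable_compound _ FC).
  under eq_fun do rewrite -prodE.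
  apply/measurable_EFinP.
  rewrite (_ : _ \o _ = (fun w => \prod_(j <= i < n) (pois (rate w i) (k' v i))%:E)).
    by apply: emeasurable_prod => i; exact: (@measurable_pois_rate _ _ _ _ _ mu D mD lambda mlambda lambda_ge0 A mA AD).
  by apply/funext => w /=; rewrite prodEFin.
- move=> v w _; rewrite lee_fin mulr_ge0//.
    by case/andP: (compound_bound j c (rate0 w) FC (x + c j * v%:R)%R).
  by rewrite -prodE prodr_ge0// => i _; exact: pois_ge0.
Qed.

(** Given the intensity, the counts are independent Poisson variables. *)
Lemma expectation_counts (F : R -> R) C : (forall x, (0 <= F x <= C)%R) ->
  measurable_fun setT F ->
  \int[P]_w (F (\sum_(i < n) c i * count w i)%R)%:E =
  \int[P]_w (compound n (rate w) c F 0)%:E.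
Proof.
move=> FC mF; have := @step F C n (fun=> 0%N) 0%R FC mF (leqnn n).
rewrite (_ : tail_event n _ = setT); last first.
  by apply/seteqP; split => // w _ i; rewrite ltnNge; case: leqP.
under eq_integral do rewrite add0r.
by move=> ->; apply: eq_integral => w _; rewrite big_geq// mulr1.
Qed.

End cox_compound.

(** * Exponential moments of variables of bounded oscillation *)

Section subgaussian.
Local Open Scope ring_scope.
Context {R : realType}.

Lemma expR1_le3 : expR 1 <= 3 :> R.
Proof.
have -> : (1:R) = 6%:R * 6^-1 by rewrite mulfV.
rewrite expRM_natl.
(* e^(- 1 / 6) >= 5 / 6, and (6 / 5)^6 is just below 3. *)
have h : expR (6^-1) <= 6 / 5 :> R.
  have := @expR_ge1Dx R (- 6^-1); rewrite expRN => h.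
  rewrite -[leLHS]invrK -[leRHS]invrK lef_pV2 ?posrE ?invr_gt0 ?expR_gt0//.
  apply: le_trans h; lra.
apply: (@le_trans _ _ ((6 / 5) ^+ 6)); last by lra.
by rewrite lerXn2r ?nnegrE ?expR_ge0//; lra.
Qed.

(** For l <= 1 the bound phi l <= l^2 phi 1 <= l^2 suffices; for larger l, e^l is
    at most e^(l^2). *)
Lemma phi_le_expsq (l : R) : 0 <= l -> 1 + phi l <= expR (l ^+ 2).
Proof.
move=> l0; have [l1|l1] := leP l 1.
  have := @phi_scale R l 1; rewrite mulr1 ger0_norm// => /(_ l1 ler01) h.
  have := @expR_ge1Dx R (l ^+ 2); apply: le_trans.
  rewrite lerD2l (le_trans h)// ler_piMr ?sqr_ge0//.
  by have := expR1_le3; rewrite /phi; lra.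
rewrite /phi; apply: (@le_trans _ _ (expR l)); first by lra.
by rewrite ler_expR expr2 ler_peMl// ltW.
Qed.

End subgaussian.

Section bounded_exponential_moment.
Context d (Omega : measurableType d) (R : realType) (P : probability Omega R).

(** U stays within l of its mean m, so e^U <= e^m (1 + (U - m) + phi l), where the
    middle term has mean 0. *)
Lemma exp_moment_oscillation (U : Omega -> R) (C l : R) (W : set Omega) :
  measurable_fun setT U -> (forall w, (0 <= U w <= C)%R) ->
  {ae P, forall w, W w} ->
  (forall w w', W w -> W w' -> (`|U w - U w'| <= l)%R) ->
  \int[P]_w (expR (U w))%:E <= (expR (fine (\int[P]_w (U w)%:E) + l ^+ 2))%:E.
Proof.
move=> mU UC ae_W osc.
have Poo : P setT < +oo by rewrite (le_lt_trans (probability_le1 _ _)) ?ltry.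
have iU : P.-integrable setT (EFin \o U) by apply: (@bounded_integrable R _ _ _ _ _ C).
have fU : \int[P]_w (U w)%:E \is a fin_num by exact: (integrable_fin_num measurableT iU).
set m := fine _.
have mE : \int[P]_w (U w)%:E = m%:E by rewrite /m fineK.
have ic (c : R) : P.-integrable setT (EFin \o cst c) by exact: finite_measure_integrable_cst.
have icst (c : R) : \int[P]_w c%:E = c%:E.
  have := @integral_cst _ _ _ P setT measurableT c%:E; rewrite /cst => ->.
  by rewrite -[RHS]mule1; congr (_ * _); exact: probability_setT.
have mon (V1 V2 : Omega -> R) : P.-integrable setT (EFin \o V1) -> P.-integrable setT (EFin \o V2) ->
    {ae P, forall w, (V1 w <= V2 w)%R} -> \int[P]_w (V1 w)%:E <= \int[P]_w (V2 w)%:E.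
  move=> i1 i2 h; apply: ge_integrable_integral => //.
  exact: measurable_int i2.
have dev w : W w -> (`|U w - m| <= l)%R.
  move=> Ww.
  have h1 : (m <= U w + l)%R.
    rewrite -lee_fin -mE -(icst (U w + l)%R); apply: (mon U (cst (U w + l)%R)) => //.
    by apply: filterS ae_W => w' /osc /(_ Ww); rewrite ler_norml /= => /andP[_]; lra.
  have h2 : (U w - l <= m)%R.
    rewrite -lee_fin -mE -(icst (U w - l)%R); apply: (mon (cst (U w - l)%R) U) => //.
    by apply: filterS ae_W => w' /osc /(_ Ww); rewrite ler_norml /= => /andP[]; lra.
  by rewrite ler_norml; apply/andP; split; lra.
(* A point of W shows that l is nonnegative. *)
have [w0 Ww0] : exists w, W w.
  apply: contrapT => h; have [S [mS PS sS]] := ae_W.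
  have : P setT = 0.
    apply/eqP; rewrite eq_le measure_ge0 andbT -PS le_measure ?inE//.
    by move=> w _; apply: sS => Ww; apply: h; exists w.
  by move=> /(etrans (esym (probability_setT P))) /eqP; rewrite onee_eq0.
have l0 : (0 <= l)%R by rewrite (le_trans _ (dev _ Ww0)).
pose V w := (expR m * (1 + (U w - m) + phi l))%R.
have iV : P.-integrable setT (EFin \o V).
  rewrite (_ : EFin \o V = (fun w => (expR m)%:E * (((EFin \o U) \+ (EFin \o cst (1 - m + phi l)%R)) w))).
    by apply: integrableZl => //; apply: integrableD.
  by apply/funext => w; rewrite /= -EFinD -EFinM /V; congr (_ * _)%:E; ring.
have intV : \int[P]_w (V w)%:E = (expR m * (1 + phi l))%:E.
  rewrite (eq_integral (fun w => (expR m)%:E * (((EFin \o U) \+ (EFin \o cst (1 - m + phi l)%R)) w))).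
    rewrite integralZl//; last exact: integrableD.
    rewrite integralD//= mE icst -EFinD -EFinM; congr (_ * _)%:E; ring.
  by move=> w _; rewrite /= -EFinD -EFinM /V; congr (_ * _)%:E; ring.
have ie : P.-integrable setT (EFin \o (expR \o U)).
  apply: (@bounded_integrable R _ _ _ _ _ (expR C)) => //.
    exact: measurableT_comp.
  by move=> w _; rewrite /= expR_ge0 ler_expR; case/andP: (UC w).
apply: (@le_trans _ _ (\int[P]_w (V w)%:E)).
  apply: (mon (expR \o U) V) => //; apply: filterS ae_W => w Ww /=.
  rewrite /V -{1}(subrK m (U w)) addrC expRD ler_pM2l ?expR_gt0//.
  have := phi_le (dev w Ww); rewrite {1}/phi; lra.
by rewrite intV expRD lee_fin ler_pM2l ?expR_gt0// phi_le_expsq.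
Qed.

End bounded_exponential_moment.

(** * Laplace transforms of weighted counts *)

Section laplace_simple.
Context d (Omega : measurableType d) (R : realType) (P : probability Omega R).
Context dZ (Z : measurableType dZ) (mu : {sigma_finite_measure set Z -> \bar R}).
Variables (D : set Z) (mD : measurable D) (lambda : Z -> Omega -> R).
Variable N : R.-ker Omega ~> Z.
Hypothesis mlambda : measurable_fun (D `*` [set: Omega])
  (fun p : Z * Omega => lambda p.1 p.2).
Hypothesis lambda_ge0 : forall z w, D z -> (0 <= lambda z w)%R.
Hypothesis coxN : conditionally_poisson P mu D lambda N.
Variables (g : Z -> R) (mg : measurable_fun D g).
Variables (f : R -> R) (C L S delta : R).
Hypothesis mf : measurable_fun [set: R] f.
Hypothesis fC : forall x, (0 <= f x <= C)%R.
Hypothesis L0 : (0 <= L)%R.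
Hypothesis fL : lipschitz_with L f.
Variable W : set Omega.
Hypothesis ae_W : {ae P, forall w, W w}.
Hypothesis W_fin : forall w, W w -> \int[mu]_(z in D) (lambda z w)%:E < +oo.
Hypothesis W_phi : forall w, W w ->
  \int[mu]_(z in D) (phi (L * `|g z|) * lambda z w)%:E <= S%:E.
Hypothesis W_osc : forall w w', W w -> W w' ->
  \int[mu]_(z in D) (`|g z| * `|lambda z w - lambda z w'|)%:E <= delta%:E.

Variables (n : nat) (A : nat -> set Z) (c : nat -> R).
Hypothesis mA : forall i, measurable (A i).
Hypothesis AD : forall i, A i `<=` D.
Hypothesis tA : trivIset setT A.
Hypothesis cg : forall i z, A i z -> (`|c i| <= `|g z|)%R.

Lemma sum_integral_le (h : Z -> \bar R) : measurable_fun D h ->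
  (forall z, D z -> 0 <= h z) ->
  \sum_(i < n) \int[mu]_(z in A i) h z <= \int[mu]_(z in D) h z.
Proof.
move=> mh h0.
have UD : \big[setU/set0]_(i <- iota 0 n) A i `<=` D.
  by elim: (iota 0 n) => [|i s IH]; rewrite ?big_nil ?big_cons// => z [/AD|/IH].
have mU : measurable (\big[setU/set0]_(i <- iota 0 n) A i).
  by apply: bigsetU_measurable.
rewrite -(big_mkord xpredT (fun i => \int[mu]_(z in A i) h z)) /index_iota subn0.
rewrite -ge0_integral_bigsetU//.
- exact: ge0_subset_integral.
- exact: iota_uniq.
- exact: sub_trivIset tA.
- exact: measurable_funS mh.
- by move=> z /UD; exact: h0.
Qed.

Let mlam w B : measurable B -> B `<=` D -> measurable_fun B (lambda^~ w).
Proof. exact: (@measurable_lambda1 _ _ _ _ _ D mD lambda mlambda B w). Qed.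

Let mphig : measurable_fun D (fun z => phi (L * `|g z|)).
Proof.
apply: (measurableT_comp measurable_phi); apply: measurable_funM; first exact: measurable_cst.
exact: measurableT_comp.
Qed.

Let rateE w i : W w -> (rate mu lambda A w i)%:E = \int[mu]_(z in A i) (lambda z w)%:E.
Proof.
move=> Ww; rewrite /rate fineK//.
exact: (@mean_fin _ _ _ _ _ mu D mD lambda mlambda lambda_ge0 (A i) w (mA i) (@AD i) (W_fin Ww)).
Qed.

Lemma sum_rate_phi w : W w ->
  (\sum_(i < n) rate mu lambda A w i * phi (L * `|c i|) <= S)%R.
Proof.
move=> Ww; rewrite -lee_fin; apply: le_trans (W_phi Ww).
rewrite -sumEFin; apply: le_trans (sum_integral_le _ _).
- apply: lee_sum => i _; rewrite EFinM rateE// muleC -ge0_integralZl//; last 3 first.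
  + by apply/measurable_EFinP; exact: mlam.
  + by move=> z Az; rewrite lee_fin lambda_ge0//; exact: AD Az.
  + by rewrite lee_fin phi_ge0.
  apply: ge0_le_integral => //.
  + by move=> z Az; rewrite -EFinM lee_fin mulr_ge0 ?phi_ge0 ?lambda_ge0//; exact: AD Az.
  + apply/measurable_EFinP; apply: measurable_funM; first exact: measurable_cst.
    exact: mlam.
  + apply/measurable_EFinP; apply: measurable_funM; last exact: mlam.
    exact: measurable_funS mphig.
  + move=> z Az; rewrite -EFinM lee_fin ler_wpM2r//.
      by rewrite lambda_ge0//; exact: AD Az.
    by apply: phi_le; rewrite normrM normr_id (ger0_norm L0) ler_wpM2l// (cg Az).
- by apply/measurable_EFinP; apply: measurable_funM => //; exact: mlam.
- by move=> z Dz; rewrite lee_fin mulr_ge0 ?phi_ge0 ?lambda_ge0.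
Qed.

Lemma sum_rate_osc w w' : W w -> W w' ->
  (\sum_(i < n) `|c i| * `|rate mu lambda A w i - rate mu lambda A w' i| <= delta)%R.
Proof.
move=> Ww Ww'; rewrite -lee_fin; apply: le_trans (W_osc Ww Ww').
have mdif B : measurable B -> B `<=` D ->
    measurable_fun B (fun z => `|lambda z w - lambda z w'|)%R.
  by move=> mB BD; apply: measurableT_comp => //; apply: measurable_funB; exact: mlam.
rewrite -sumEFin; apply: le_trans (sum_integral_le _ _).
- apply: lee_sum => i _.
  have il v : W v -> mu.-integrable (A i) (fun z => (lambda z v)%:E).
    move=> Wv; apply/integrableP; split; first by apply/measurable_EFinP; exact: mlam.
    rewrite (eq_integral (fun z => (lambda z v)%:E)); last first.
      by move=> z /set_mem Az; rewrite gee0_abs// lee_fin lambda_ge0//; exact: AD Az.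
    by rewrite -rateE// ltry.
  have -> : (`|c i| * `|rate mu lambda A w i - rate mu lambda A w' i|)%:E =
      `|c i|%:E * `| \int[mu]_(z in A i) (lambda z w - lambda z w')%:E |.
    rewrite EFinM; congr (_ * _); rewrite -abse_EFin EFinB !rateE//.
    by rewrite -integralB//; exact: il.
  apply: (@le_trans _ _ (`|c i|%:E * \int[mu]_(z in A i) `|(lambda z w - lambda z w')%:E|)).
    rewrite lee_wpmul2l// le_abse_integral//.
    by apply/measurable_EFinP; apply: measurable_funB; exact: mlam.
  rewrite -ge0_integralZl//; last first.
    by apply/measurable_EFinP; exact: mdif.
  apply: ge0_le_integral => //.
  + apply/measurable_EFinP; apply: measurable_funM; first exact: measurable_cst.
    exact: mdif.
  + apply/measurable_EFinP; apply: measurable_funM; last exact: mdif.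
    by apply: measurableT_comp => //; exact: measurable_funS mg.
  + by move=> z Az; rewrite -EFinM lee_fin ler_wpM2r// (cg Az).
- apply/measurable_EFinP; apply: measurable_funM; last exact: mdif.
  exact: measurableT_comp.
- by move=> z Dz; rewrite lee_fin mulr_ge0.
Qed.

Definition weighted_count w : R := (\sum_(i < n) c i * count N A w i)%R.

(** Given the intensity, [compound_exp] compares with the exponential of the
    conditional mean U; and U, as a function of the intensity, oscillates by at
    most L * delta by [compound_rate]. *)
Lemma laplace_weighted_count (X := weighted_count) :
  \int[P]_w (expR (f (X w)))%:E <=
  (expR (fine (\int[P]_w (f (X w))%:E) + (S + (L * delta) ^+ 2)))%:E.
Proof.
have lambda_fin : {ae P, forall w, \int[mu]_(z in D) (lambda z w)%:E < +oo}.
  by apply: filterS ae_W => w; exact: W_fin.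
have ef x : (0 <= (expR \o f) x <= expR C)%R.
  by rewrite /= expR_ge0 ler_expR; case/andP: (fC x).
have mef : measurable_fun [set: R] (expR \o f) by exact: measurableT_comp.
have EX (F : R -> R) C' : (forall x, (0 <= F x <= C')%R) -> measurable_fun [set: R] F ->
    \int[P]_w (F (X w))%:E = \int[P]_w (compound n (rate mu lambda A w) c F 0%R)%:E.
  by move=> FC mF; exact: (expectation_counts mD mlambda lambda_ge0 coxN lambda_fin mA AD tA c n FC mF).
have r0 w i : (0 <= rate mu lambda A w i)%R by exact: (rate_ge0 mu lambda_ge0 AD).
have mcomp (F : R -> R) C' : (forall x, (0 <= F x <= C')%R) ->
    measurable_fun setT (fun w => compound n (rate mu lambda A w) c F 0%R).
  by move=> FC; exact: (@measurable_compound _ _ _ _ _ mu D mD lambda mlambda lambda_ge0 A mA AD c F C' n FC).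
pose U w := compound n (rate mu lambda A w) c f 0%R.
have UC w : (0 <= U w <= C)%R by exact: compound_bound.
have osc w w' : W w -> W w' -> (`|U w - U w'| <= L * delta)%R.
  move=> Ww Ww'; rewrite (le_trans (compound_rate n c (r0 w) (r0 w') fC fL 0%R))//.
  by rewrite ler_wpM2l// sum_rate_osc.
have := exp_moment_oscillation (mcomp _ _ fC) UC ae_W osc.
rewrite -/U (EX _ _ ef mef) (EX _ _ fC mf) => mom.
have mEU : measurable_fun setT (fun w => (expR (U w))%:E).
  apply/measurable_EFinP; apply: measurableT_comp => //; exact: (mcomp _ _ fC).
apply: (@le_trans _ _ (\int[P]_w ((expR S)%:E * (expR (U w))%:E))).
  apply: ae_ge0_le_integral => //.
  - by move=> w _; rewrite lee_fin; case/andP: (compound_bound n c (r0 w) ef 0%R).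
  - by apply/measurable_EFinP; exact: (mcomp _ _ ef).
  - exact: (emeasurable_funM (measurable_cst _) mEU).
  - apply: filterS ae_W => w Ww _; rewrite -EFinM lee_fin -expRD addrC.
    rewrite (le_trans (compound_exp n c (r0 w) fC fL 0%R))// ler_expR lerD2l.
    exact: sum_rate_phi.
have eS : 0 <= (expR S)%:E by rewrite lee_fin expR_ge0.
have eU w : setT w -> 0 <= (expR (U w))%:E by move=> _; rewrite lee_fin expR_ge0.
rewrite ge0_integralZl//.
apply: (@le_trans _ _ ((expR S)%:E * (expR (fine (\int[P]_w (U w)%:E) + (L * delta) ^+ 2))%:E)).
  by rewrite lee_wpmul2l.
by rewrite -EFinM -expRD lee_fin ler_expR; lra.
Qed.

End laplace_simple.

(** * Approximation by simple functions *)

Section staircase.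
Context dZ (Z : measurableType dZ) (R : realType).
Variables (D : set Z) (mD : measurable D) (g : Z -> R) (mg : measurable_fun D g).
Implicit Types (k i : nat) (z : Z).

Let eps k : R := (k.+1%:R)^-1%R.

Let eps_gt0 k : (0 < eps k)%R.
Proof. by rewrite invr_gt0. Qed.

(** The parity of i encodes the sign of g, its half the size of |g|. *)
Definition cell k i : set Z :=
  D `&` [set z | (g z < 0)%R = odd i /\
                 (i./2%:R * eps k <= `|g z| < (i./2).+1%:R * eps k)%R].

(** Rounding towards 0 keeps the approximations dominated by |g|. *)
Definition cell_value k i : R := ((-1) ^+ odd i * (i./2%:R * eps k))%R.

(** Enough cells to reach |g| = k.+1 with mesh 1 / k.+1 and both signs. *)
Definition cell_number k : nat := (2 * k.+1 ^ 2)%N.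

Lemma cell_sub k i : cell k i `<=` D. Proof. by move=> z []. Qed.

Lemma measurable_cell k i : measurable (cell k i).
Proof.
have mn : measurable_fun D (fun z => `|g z|)%R by exact: measurableT_comp.
have m1 : measurable (D `&` [set z | (g z < 0)%R = odd i]).
  have mo : measurable [set odd i] by [].
  by have := measurable_fun_ltr mg (measurable_cst (0%R : R)) mD mo; exact.
have m2 : measurable (D `&` [set z | (i./2%:R * eps k <= `|g z| < (i./2).+1%:R * eps k)%R]).
  have mo : measurable (`[(i./2%:R * eps k)%R, ((i./2).+1%:R * eps k)%R[%classic : set R).
    exact: measurable_itv.
  rewrite (_ : _ `&` _ = D `&` ((fun z => `|g z|%R) @^-1`
    (`[(i./2%:R * eps k)%R, ((i./2).+1%:R * eps k)%R[%classic : set R))); first exact: mn.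
  by apply/seteqP; split=> z /=; rewrite in_itv.
rewrite (_ : cell k i = (D `&` [set z | (g z < 0)%R = odd i]) `&`
  (D `&` [set z | (i./2%:R * eps k <= `|g z| < (i./2).+1%:R * eps k)%R])).
  exact: measurableI.
by apply/seteqP; split => z /=; rewrite /cell /=; tauto.
Qed.

Lemma trivIset_cell k : trivIset setT (cell k).
Proof.
move=> i j _ _ [z [[_ /= [oi /andP[i1 i2]]] [_ /= [oj /andP[j1 j2]]]]].
rewrite -(odd_double_half i) -(odd_double_half j) -oi -oj.
suff -> : i./2 = j./2 by [].
have := le_lt_trans i1 j2; have := le_lt_trans j1 i2.
by rewrite !ltr_pM2r// !ltr_nat !ltnS => h1 h2; apply/eqP; rewrite eqn_leq h1 h2.
Qed.

Lemma cell_value_le k i z : cell k i z -> (`|cell_value k i| <= `|g z|)%R.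
Proof.
move=> [_ /= [_ /andP[h _]]]; rewrite /cell_value normrM normrX normrN1 expr1n mul1r.
by rewrite ger0_norm// mulr_ge0// ltW.
Qed.

Definition staircase k z : R :=
  (\sum_(i < cell_number k) cell_value k i * \1_(cell k i) z)%R.

Let idx k z : nat := (Num.truncn (`|g z| / eps k)).*2 + (g z < 0)%R.

Let idx_odd k z : odd (idx k z) = (g z < 0)%R.
Proof. by rewrite /idx oddD odd_double; case: (_ < _)%R. Qed.

Let idx_half k z : (idx k z)./2 = Num.truncn (`|g z| / eps k).
Proof. by rewrite /idx addnC half_bit_double. Qed.

Let idx_itv k z : ((idx k z)./2%:R * eps k <= `|g z| < ((idx k z)./2).+1%:R * eps k)%R.
Proof.
rewrite idx_half -ler_pdivlMr// -ltr_pdivrMr//.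
by apply: truncn_itv; rewrite divr_ge0// ltW.
Qed.

Let cell_idx k z : D z -> cell k (idx k z) z.
Proof. by move=> Dz; split => //=; rewrite idx_odd idx_itv. Qed.

Lemma staircaseE k z : D z -> staircase k z =
  if (idx k z < cell_number k)%N then cell_value k (idx k z) else 0%R.
Proof.
move=> Dz; have notin i : i != idx k z -> \1_(cell k i) z = 0%R :> R.
  move=> ii; rewrite indicE memNset// => ci.
  move/eqP: ii; apply; apply: (@trivIset_cell k) => //.
  by exists z; split => //; exact: cell_idx.
case: ifPn => h.
  rewrite /staircase (bigD1 (Ordinal h))//= big1 ?addr0.
    by rewrite indicE mem_set ?mulr1//; exact: cell_idx.
  by move=> i ii; rewrite notin ?mulr0//.
rewrite /staircase big1// => i _; rewrite notin ?mulr0//.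
by apply: contra h => /eqP <-.
Qed.

Lemma staircase_le k z : D z -> (`|staircase k z| <= `|g z|)%R.
Proof.
move=> Dz; rewrite staircaseE//; case: ifPn => _; last by rewrite normr0.
exact/cell_value_le/cell_idx.
Qed.

Lemma staircase_cvg z : D z -> staircase k z @[k --> \oo] --> g z.
Proof.
move=> Dz; apply/cvgrPdist_le => e e0.
near=> k.
have gk : (`|g z| < k.+1%:R)%R.
  by apply: (@lt_trans _ _ k%:R%R); [near: k; exact: nbhs_infty_gtr|rewrite ltr_nat].
have ek : (eps k <= e)%R.
  near: k; have /cvgrPdist_le/(_ _ e0) := @cvg_harmonic R.
  by apply: filterS => j; rewrite sub0r normrN ger0_norm ?harmonic_ge0.
have idx_lt : (idx k z < cell_number k)%N.
  have : (Num.truncn (`|g z| / eps k) < k.+1 ^ 2)%N.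
    rewrite -(ltr_nat R); apply: (@le_lt_trans _ _ (`|g z| / eps k)%R).
      by rewrite truncn_le// divr_ge0// ltW.
    by rewrite /eps invrK natrX expr2 ltr_pM2r.
  rewrite /idx /cell_number; case: (_ < _)%R; lia.
rewrite staircaseE// idx_lt (le_trans _ ek)//.
rewrite -[X in (X - _)%R](mulr_sign_norm (g z)) /cell_value idx_odd -mulrBr.
rewrite normrM normrX normrN1 expr1n mul1r.
have /andP[h1 h2] := idx_itv k z.
rewrite ger0_norm ?subr_ge0// lerBlDr (le_trans (ltW h2))//.
by rewrite -natr1 mulrDl mul1r addrC.
Unshelve. all: end_near. Qed.

End staircase.

(** * Laplace transforms of Cox integrals *)

Section fin_integrable.
Context d (T : measurableType d) (R : realType).

Lemma integral_fin_integrable (mu : {measure set T -> \bar R}) (D : set T) (f : T -> \bar R) :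
  measurable D -> measurable_fun D f -> \int[mu]_(x in D) f x \is a fin_num ->
  mu.-integrable D f.
Proof.
move=> mD mf; rewrite integralE => fin; apply/integrableP; split => //.
have -> : \int[mu]_(x in D) `|f x| = \int[mu]_(x in D) (f^\+ x + f^\- x).
  by apply: eq_integral => x _; have := congr1 (fun h => h x) (fune_abse f).
rewrite ge0_integralD//; [|exact: measurable_funepos|exact: measurable_funeneg].
have p0 : 0 <= \int[mu]_(x in D) f^\+ x by exact: integral_ge0.
have n0 : 0 <= \int[mu]_(x in D) f^\- x by exact: integral_ge0.
(* The difference +oo - +oo is -oo, so a finite one has finite terms. *)
move: fin p0 n0; case: integral => [r| |]; case: integral => [s| |] //=.
by move=> _ _ _; rewrite -EFinD ltry.
Qed.

End fin_integrable.

Section laplace_limit.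
Context d (Omega : measurableType d) (R : realType) (P : probability Omega R).
Context dZ (Z : measurableType dZ) (mu : {sigma_finite_measure set Z -> \bar R}).
Variables (D : set Z) (mD : measurable D) (lambda : Z -> Omega -> R).
Variable N : R.-ker Omega ~> Z.
Hypothesis mlambda : measurable_fun (D `*` [set: Omega])
  (fun p : Z * Omega => lambda p.1 p.2).
Hypothesis lambda_ge0 : forall z w, D z -> (0 <= lambda z w)%R.
Hypothesis coxN : conditionally_poisson P mu D lambda N.
Variables (g : Z -> R) (mg : measurable_fun D g).
Variables (f : R -> R) (C L S delta : R).
Hypothesis mf : measurable_fun [set: R] f.
Hypothesis fC : forall x, (0 <= f x <= C)%R.
Hypothesis L0 : (0 <= L)%R.
Hypothesis fL : lipschitz_with L f.
Variable W : set Omega.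
Hypothesis ae_W : {ae P, forall w, W w}.
Hypothesis W_fin : forall w, W w -> \int[mu]_(z in D) (lambda z w)%:E < +oo.
Hypothesis W_phi : forall w, W w ->
  \int[mu]_(z in D) (phi (L * `|g z|) * lambda z w)%:E <= S%:E.
Hypothesis W_osc : forall w w', W w -> W w' ->
  \int[mu]_(z in D) (`|g z| * `|lambda z w - lambda z w'|)%:E <= delta%:E.
Variable G : Omega -> R.
Hypothesis mG : measurable_fun setT G.
Hypothesis GE : {ae P, forall w, (G w)%:E = \int[N w]_(z in D) (g z)%:E}.

Let X k w := weighted_count N (cell_number k) (cell D g k) (cell_value R k) w.

Let mcell k i : measurable (cell D g k i). Proof. exact: measurable_cell. Qed.

Let X_integral k w : (forall i, exists v : nat, N w (cell D g k i) = v%:R%:E) ->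
  (X k w)%:E = \int[N w]_(z in D) (staircase D g k z)%:E.
Proof.
move=> Nfin.
have fin i : N w (cell D g k i) \is a fin_num by have [v ->] := Nfin i.
have ii i : (N w).-integrable D (fun z => (\1_(cell D g k i) z)%:E).
  apply/integrableP; split.
    by apply/measurable_EFinP/measurable_funTS/measurable_indic.
  rewrite (eq_integral (fun z => (\1_(cell D g k i) z)%:E)); last first.
    by move=> z _; rewrite gee0_abs// lee_fin.
  rewrite integral_indic// setIidl; last exact: cell_sub.
  by rewrite -ge0_fin_numE.
under eq_integral do rewrite -sumEFin.
rewrite integral_sum//.
  rewrite /X /weighted_count -sumEFin; apply: eq_bigr => i _.
  under eq_integral do rewrite EFinM.
  rewrite integralZl// integral_indic// setIidl; last exact: cell_sub.
  by rewrite /count EFinM fineK.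
move=> i; under eq_fun do rewrite EFinM.
exact: integrableZl.
Qed.

(** Almost surely g is N-integrable, its integral being the finite G, and it
    dominates its staircase approximations. *)
Lemma ae_weighted_count_cvg : {ae P, forall w, X k w @[k --> \oo] --> G w}.
Proof.
have lambda_fin : {ae P, forall w, \int[mu]_(z in D) (lambda z w)%:E < +oo}.
  by apply: filterS ae_W => w; exact: W_fin.
have aeN : {ae P, forall w, forall k i, exists v : nat, N w (cell D g k i) = v%:R%:E}.
  apply: ae_foralln => k; apply: ae_foralln => i.
  by apply: (ae_count_nat mD mlambda lambda_ge0 coxN lambda_fin (mcell k i)); exact: cell_sub.
apply: filterS2 aeN GE => w Nfin Gw.
have mgE : measurable_fun D (EFin \o g) by exact/measurable_EFinP.
have ig : (N w).-integrable D (EFin \o g).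
  by apply: integral_fin_integrable => //; rewrite -Gw.
have ig' : (N w).-integrable D (abse \o (EFin \o g)) by exact: integrable_abse.
have msg k : measurable_fun D (EFin \o staircase D g k).
  apply/measurable_EFinP/measurable_sum => i; apply: measurable_funM; first exact: measurable_cst.
  by apply: measurable_funTS; exact: measurable_indic.
have [|||||_ _ cv] := @dominated_convergence _ _ R (N w) D mD
  (fun k => EFin \o staircase D g k) (EFin \o g) (abse \o (EFin \o g)) _ _ _ _ _.
- exact: msg.
- exact: mgE.
- apply: aeW => z Dz; apply: cvg_EFin; first exact: nearW.
  exact: (@staircase_cvg _ Z R D g z Dz).
- exact: ig'.
- by apply: aeW => z k Dz; rewrite /= lee_fin staircase_le.
have : (X k w)%:E @[k --> \oo] --> (G w)%:E.
  rewrite Gw; apply: cvg_trans cv; apply: near_eq_cvg; apply: nearW => k /=.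
  by rewrite X_integral.
by move/fine_cvg.
Qed.

(** The bound for weighted counts is stable under their convergence to G: f is
    continuous and bounded. *)
Theorem laplace_cox :
  \int[P]_w (expR (f (G w)))%:E <=
  (expR (fine (\int[P]_w (f (G w))%:E) + (S + (L * delta) ^+ 2)))%:E.
Proof.
have mX k : measurable_fun setT (X k).
  apply: measurable_sum => i; apply: measurable_funM; first exact: measurable_cst.
  by apply: measurable_count => j; exact: mcell.
have Poo : P setT < +oo by rewrite (le_lt_trans (probability_le1 _ _)) ?ltry.
have fG w : X k w @[k --> \oo] --> G w -> f (X k w) @[k --> \oo] --> f (G w).
  move=> XG; apply/cvgrPdist_le => e e0.
  have /cvgrPdist_le/(_ (e / (L + 1))%R) := XG.
  rewrite divr_gt0// ?ltr_wpDl// => /(_ isT); apply: filterS => k h.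
  rewrite (le_trans (fL _ _))//.
  apply: (@le_trans _ _ ((L + 1) * `|G w - X k w|)%R).
    by rewrite ler_wpM2r// lerDl.
  by rewrite mulrC -ler_pdivlMr// ltr_wpDl.
have cvgE (F : R -> R) (K : R) : (forall x, (0 <= F x <= K)%R) -> measurable_fun [set: R] F ->
    (forall w, X k w @[k --> \oo] --> G w -> F (X k w) @[k --> \oo] --> F (G w)) ->
    fine (\int[P]_w (F (X k w))%:E) @[k --> \oo] --> fine (\int[P]_w (F (G w))%:E) /\
    forall V : Omega -> R, measurable_fun setT V -> \int[P]_w (F (V w))%:E \is a fin_num.
  move=> FK mF FG.
  have fin (V : Omega -> R) : measurable_fun setT V -> \int[P]_w (F (V w))%:E \is a fin_num.
    move=> mV; apply: (integrable_fin_num measurableT).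
    apply: (@bounded_integrable R _ _ _ _ (F \o V) K) => //.
      exact: measurableT_comp.
    by move=> w _; exact: FK.
  split => //; apply: fine_cvg; rewrite fineK; last exact: fin.
  have [|||||_ _ cv] := @dominated_convergence _ _ R P setT measurableT
    (fun k w => (F (X k w))%:E) (fun w => (F (G w))%:E) (cst K%:E) _ _ _ _ _.
  - by move=> k; apply/measurable_EFinP; exact: measurableT_comp.
  - by apply/measurable_EFinP; exact: measurableT_comp.
  - apply: filterS ae_weighted_count_cvg => w /FG h _.
    by apply: cvg_EFin => //; exact: nearW.
  - exact: finite_measure_integrable_cst.
  - apply: aeW => w k _; have /andP[F0 F1] := FK (X k w).
    by rewrite gee0_abs ?lee_fin.
  exact: cv.
have ef x : (0 <= (expR \o f) x <= expR C)%R.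
  by rewrite /= expR_ge0 ler_expR; case/andP: (fC x).
have mef : measurable_fun [set: R] (expR \o f) by exact: measurableT_comp.
have [cf _] := cvgE f C fC mf fG.
have [|ce fine_e] := cvgE (expR \o f) (expR C) ef mef.
  by move=> w /fG h; exact: (cvg_comp _ _ h (@continuous_expR R _)).
rewrite -[X in X <= _]fineK; last exact: fine_e.
rewrite lee_fin.
apply: (@ler_cvg_to _ _ _ _ _ (fun k => expR (fine (\int[P]_w (f (X k w))%:E) + (S + (L * delta) ^+ 2))) _ _ ce).
  apply: continuous_cvg; first exact: continuous_expR.
  by apply: cvgD => //; exact: cvg_cst.
apply: nearW => k; rewrite -lee_fin fineK; last exact: fine_e.
apply: (laplace_weighted_count mD mlambda lambda_ge0 coxN mg mf fC L0 fL ae_W W_fin W_phi W_osc) => //.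
- exact: cell_sub.
- exact: trivIset_cell.
- by move=> i z; exact: cell_value_le.
Qed.

End laplace_limit.

(** * Symmetrization in the order of time *)

Section product_ae.
Context d1 d2 (T1 : measurableType d1) (T2 : measurableType d2) (R : realType).
Variables (m1 : {sigma_finite_measure set T1 -> \bar R})
  (m2 : {sigma_finite_measure set T2 -> \bar R}).

Lemma ae_ysection (Q : T1 * T2 -> Prop) :
  {ae m1 \x m2, forall p, Q p} ->
  {ae m2, forall y, {ae m1, forall x, Q (x, y)}}.
Proof.
move=> [S [mS S0 QS]].
have mI : measurable_fun setT (EFin \o (\1_S : T1 * T2 -> R)).
  by apply/measurable_EFinP; exact: measurable_indic.
have I0 p : 0 <= (EFin \o (\1_S : T1 * T2 -> R)) p by rewrite lee_fin.
have h := @fubini_tonelli2 _ _ _ _ _ m1 m2 _ mI I0.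
have e : \int[m2]_y (m1 \o ysection S) y = 0.
  rewrite -indic_fubini_tonelli_GE// -h /= integral_indic//.
  by rewrite setIT.
have mG : measurable_fun setT (m1 \o ysection S) by exact: measurable_fun_ysection.
have : ae_eq m2 setT (m1 \o ysection S) (cst 0).
  apply/(ae_eq_integral_abs _ measurableT mG).
  by rewrite -[RHS]e; apply: eq_integral => y _; rewrite gee0_abs.
apply: filterS => y /(_ I) /= sy; exists (ysection S y); split => //.
  exact: measurable_ysection.
by move=> x /= nQ; rewrite /ysection /= inE; exact: QS.
Qed.

End product_ae.

Lemma measurable_set_le d (T : measurableType d) (R : realType) (a b : T -> R) :
  measurable_fun setT a -> measurable_fun setT b ->
  measurable [set x | (a x <= b x)%R].
Proof.
move=> ma mb; have mt : measurable [set true] by [].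
have := measurable_fun_ler ma mb measurableT mt.
by rewrite setTI; congr (measurable _); apply/seteqP; split => x /= ->.
Qed.

Section symmetrization.
Context d (T : measurableType d) (R : realType).
Variables (m : {sigma_finite_measure set T -> \bar R}) (D : set T).
Hypothesis mD : measurable D.
Variables (tau psi : T -> R).
Hypotheses (mtau : measurable_fun setT tau) (mpsi : measurable_fun D psi).
Hypothesis psi0 : forall z, D z -> (0 <= psi z)%R.

(** The square is an integral over pairs of points. In each pair one point is not
    earlier than the other, and both orders contribute equally. *)
Lemma sqr_integral_le_ordered :
  (\int[m]_(z in D) (psi z)%:E) ^+ 2 <=
  2%:E * \int[m]_(z in D) ((psi z)%:E *
           \int[m]_(y in D `&` [set y | (tau z <= tau y)%R]) (psi y)%:E).
Proof.
pose Psi : T -> \bar R := (EFin \o psi) \_ D.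
have Psi0 z : 0 <= Psi z.
  by rewrite /Psi patchE; case: ifPn => // /set_mem Dz; rewrite lee_fin psi0.
have mPsi : measurable_fun setT Psi.
  by apply/(measurable_restrictT _ mD).1/measurable_EFinP.
pose V : set (T * T) := [set p | (tau p.1 <= tau p.2)%R].
have mV : measurable V by apply: measurable_set_le; exact: measurableT_comp.
have VE z y : \1_V (z, y) = (tau z <= tau y)%R%:R :> R.
  by rewrite indicE; congr (nat_of_bool _)%:R; apply/idP/idP => [/set_mem|/mem_set].
pose H p := Psi p.1 * Psi p.2 * (\1_V p)%:E.
have mH : measurable_fun [set: T * T] H.
  apply: emeasurable_funM.
    by apply: emeasurable_funM; apply: measurableT_comp.
  by apply/measurable_EFinP; exact: measurable_indic.
have H0 p : 0 <= H p by rewrite mule_ge0 ?mule_ge0// lee_fin.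
have mH1 z : measurable_fun setT (fun y => H (z, y)).
  exact: (measurableT_comp mH (measurable_pair1 z)).
have mH2 z : measurable_fun setT (fun y => H (y, z)).
  exact: (measurableT_comp mH (measurable_pair2 z)).
have sq : (\int[m]_(z in D) (psi z)%:E) ^+ 2 =
    \int[m]_z \int[m]_y (Psi z * Psi y).
  rewrite integral_mkcond -/Psi expe2 -ge0_integralZr//; last exact: integral_ge0.
  by apply: eq_integral => z _; rewrite ge0_integralZl.
rewrite sq.
apply: (@le_trans _ _ (\int[m]_z (\int[m]_y H (z, y) + \int[m]_y H (y, z)))).
  apply: ge0_le_integral => //.
  - by move=> z _; apply: integral_ge0 => y _; rewrite mule_ge0.
  - under eq_fun do rewrite ge0_integralZl//.
    by apply: emeasurable_funM => //; exact: measurable_cst.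
  - apply: emeasurable_funD.
      exact: (@measurable_fun_fubini_tonelli_F _ _ _ _ _ m H mH H0).
    exact: (@measurable_fun_fubini_tonelli_G _ _ _ _ _ m H mH H0).
  - move=> z _; rewrite -ge0_integralD//.
    apply: ge0_le_integral => //.
    + by move=> y _; rewrite mule_ge0.
    + by apply: emeasurable_funM => //; exact: measurable_cst.
    + exact: emeasurable_funD.
    + move=> y _; rewrite /H /= !VE (muleC (Psi y)).
      rewrite -ge0_muleDr ?lee_fin// -EFinD lee_pemulr ?mule_ge0//.
      by rewrite lee_fin; case: (leP (tau z) (tau y)) => [_|/ltW ->]; rewrite ?lerDl ?lerDr.
rewrite ge0_integralD//; last 4 first.
- by move=> z _; exact: integral_ge0.
- exact: (@measurable_fun_fubini_tonelli_F _ _ _ _ _ m H mH H0).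
- by move=> z _; exact: integral_ge0.
- exact: (@measurable_fun_fubini_tonelli_G _ _ _ _ _ m H mH H0).
rewrite -(@fubini_tonelli _ _ _ _ _ m m H mH H0).
have -> : \int[m]_z \int[m]_y H (z, y) = \int[m]_(z in D) ((psi z)%:E *
           \int[m]_(y in D `&` [set y | (tau z <= tau y)%R]) (psi y)%:E).
  rewrite [RHS]integral_mkcond; apply: eq_integral => z _.
  rewrite patchE; case: ifPn => [/set_mem Dz|nDz]; last first.
    by apply: integral0_eq => y _; rewrite /H /= /Psi patchE (negbTE nDz) !mul0e.
  rewrite [in RHS]integral_mkcond -ge0_integralZl//.
  - apply: eq_integral => y _; rewrite /H /= VE /Psi !patchE (mem_set Dz) /=.
    rewrite in_setI; case: (y \in D) => /=; last by rewrite !mule0 mul0e.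
    rewrite (_ : (y \in [set y | (tau z <= tau y)%R]) = (tau z <= tau y)%R); last first.
      by apply/idP/idP => [/set_mem|/mem_set].
    by case: (_ <= _)%R; rewrite ?mule1 ?mule0.
  - apply/(measurable_restrictT _ _).1.
      by apply: measurableI => //; exact: measurable_set_le.
    by apply/measurable_EFinP; apply: measurable_funS mpsi => // y [].
  - by move=> y _; rewrite patchE; case: ifPn => // /set_mem[Dy _]; rewrite lee_fin psi0.
  - by rewrite lee_fin psi0.
by rewrite -mule2n mule_natl.
Qed.

Lemma measurable_tail_integral :
  measurable_fun D (fun z =>
    \int[m]_(y in D `&` [set y | (tau z <= tau y)%R]) (psi y)%:E).
Proof.
pose Psi : T -> \bar R := (EFin \o psi) \_ D.
have Psi0 z : 0 <= Psi z.
  by rewrite /Psi patchE; case: ifPn => // /set_mem Dz; rewrite lee_fin psi0.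
have mPsi : measurable_fun setT Psi.
  by apply/(measurable_restrictT _ mD).1/measurable_EFinP.
pose V : set (T * T) := [set p | (tau p.1 <= tau p.2)%R].
have mV : measurable V by apply: measurable_set_le; exact: measurableT_comp.
pose H p := Psi p.2 * (\1_V p)%:E.
have mH : measurable_fun [set: T * T] H.
  apply: emeasurable_funM; first exact: measurableT_comp.
  by apply/measurable_EFinP; exact: measurable_indic.
have H0 p : 0 <= H p by rewrite mule_ge0// lee_fin.
apply: measurable_funTS.
have := @measurable_fun_fubini_tonelli_F _ _ _ _ _ m H mH H0.
congr (measurable_fun _ _); apply/funext => z.
rewrite /fubini_F [RHS]integral_mkcond; apply: eq_integral => y _.
rewrite /H /Psi /= !patchE in_setI indicE.
have -> : ((z, y) \in V) = (tau z <= tau y)%R by apply/idP/idP => [/set_mem|/mem_set].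
have -> : (y \in [set y | (tau z <= tau y)%R]) = (tau z <= tau y)%R.
  by apply/idP/idP => [/set_mem|/mem_set].
by case: (y \in D); rewrite ?mul0e//=; case: (_ <= _)%R; rewrite ?mule1 ?mule0.
Qed.

End symmetrization.

(** * Comparison with the functions g1 and g2 *)

Section scalar.
Context {R : realType}.
Local Open Scope ring_scope.

(** Squared and divided by 2 (b - a), this is 2 (b - a) a^2 <= (b + a) b^2. *)
Lemma sqrt_ratio_ge (a b : R) : 0 < a -> a <= b ->
  2 * (b - a) <= b * (Num.sqrt 2 * Num.sqrt (b ^+ 2 / a ^+ 2 - 1)).
Proof.
move=> a0 ab; have b0 : 0 < b by exact: lt_le_trans ab.
rewrite -sqrtrM//.
have -> : 2 * (b - a) = b * Num.sqrt ((2 * (b - a) / b) ^+ 2).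
  rewrite sqrtr_sqr ger0_norm; last by rewrite divr_ge0 ?mulr_ge0 ?subr_ge0// ltW.
  by field; rewrite gt_eqF.
rewrite ler_pM2l// ler_wsqrtr//.
have a2 : 0 < a ^+ 2 by rewrite exprn_gt0.
have b2 : 0 < b ^+ 2 by rewrite exprn_gt0.
rewrite expr_div_n ler_pdivrMr//.
have -> : 2 * (b ^+ 2 / a ^+ 2 - 1) * b ^+ 2 = 2 * (b ^+ 2 - a ^+ 2) * b ^+ 2 / a ^+ 2.
  by field; rewrite gt_eqF.
rewrite ler_pdivlMr//.
have -> : (2 * (b - a)) ^+ 2 * a ^+ 2 = 2 * (b - a) * (2 * (b - a) * a ^+ 2) by ring.
have -> : 2 * (b ^+ 2 - a ^+ 2) * b ^+ 2 = 2 * (b - a) * ((b + a) * b ^+ 2) by ring.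
rewrite ler_wpM2l ?mulr_ge0 ?subr_ge0//.
have h1 : a * (a * (b - a)) >= 0 by rewrite !mulr_ge0 ?subr_ge0// ltW.
have h2 : b * (b - a) * (b + a) >= 0 by rewrite !mulr_ge0 ?subr_ge0 ?addr_ge0// ltW.
have h3 : a * (b - a) * b >= 0 by rewrite !mulr_ge0 ?subr_ge0// ltW.
have h4 : a * a * a >= 0 by rewrite !mulr_ge0// ltW.
nra.
Qed.

(** The difference phi (x + y) - phi x is e^x (e^y - 1) - y, and
    e^x (e^y - 1) >= (1 + x) y. *)
Lemma phi_add (x y : R) : 0 <= x -> 0 <= y -> phi x + x * y <= phi (x + y).
Proof.
move=> x0 y0; rewrite /phi expRD.
have h1 := @expR_ge1Dx R y; have h2 := @expR_ge1Dx R x.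
have h3 : expR x * (1 + y) <= expR x * expR y by rewrite ler_pM2l ?expR_gt0.
have h4 : (1 + x) * y <= expR x * y by rewrite ler_wpM2r.
lra.
Qed.

End scalar.

Section comparison.
Context d (Omega : measurableType d) (R : realType) (P : probability Omega R).
Context dZ (Z : measurableType dZ) (mu : {sigma_finite_measure set Z -> \bar R}).
Variables (D : set Z) (mD : measurable D) (tau : Z -> R).
Hypothesis mtau : measurable_fun setT tau.
Variables (alpha beta g g1 g2 : Z -> R).
Hypothesis alpha_ge0 : forall z, D z -> (0 <= alpha z)%R.
Hypothesis beta_ge0 : forall z, D z -> (0 <= beta z)%R.
Hypothesis beta_L1 : mu.-integrable D (EFin \o beta).
Hypothesis mg : measurable_fun D g.
Hypothesis g1_L2 : weighted_L2 mu D beta g1.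
Hypothesis g2_L2 : weighted_L2 mu D beta g2.
Hypothesis g1_ge : forall z, D z -> (`|g z| <= g1 z)%R.
Let later z := D `&` [set y | (tau z <= tau y)%R].
Hypothesis g2_ge : forall z, D z ->
  (Num.sqrt 2)%:E *
  sqrte (\int[mu]_(y in later z) ((g y) ^+ 2 * beta y)%:E +
         (\int[mu]_(y in later z) (`|g y| * beta y)%:E) ^+ 2) *
  sqrte ((beta z)%:E ^+ 2 / (alpha z)%:E ^+ 2 - 1) <= (g2 z)%:E.

Lemma g1_ge0 z : D z -> (0 <= g1 z)%R.
Proof. by move=> Dz; rewrite (le_trans _ (g1_ge Dz)). Qed.

Lemma g2_ge0 z : D z -> (0 <= g2 z)%R.
Proof.
move=> Dz; rewrite -lee_fin (le_trans _ (g2_ge Dz))// !mule_ge0 ?sqrte_ge0// lee_fin sqrtr_ge0.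
Qed.

Let tail z := \int[mu]_(y in later z) (`|g y| * beta y)%:E.

Let tail_ge0 z : 0 <= tail z.
Proof.
by apply: integral_ge0 => y [Dy _]; rewrite lee_fin mulr_ge0// beta_ge0.
Qed.

(** By [sqrt_ratio_ge]; of the two terms under the square root only the square of
    the tail is kept. *)
Lemma g2_tail z : D z -> (alpha z <= beta z)%R ->
  (2 * (beta z - alpha z))%:E * tail z <= (g2 z * beta z)%:E.
Proof.
move=> Dz ab; have b0 := beta_ge0 Dz; have a0 := alpha_ge0 Dz; have h2 := g2_ge0 Dz.
have [b00|bN0] := eqVneq (beta z) 0%R.
  have -> : alpha z = 0%R by apply/eqP; rewrite eq_le a0 andbT -b00.
  by rewrite b00 subrr !mulr0 mul0e.
have bp : (0 < beta z)%R by rewrite lt_def bN0.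
set B := \int[mu]_(y in later z) ((g y) ^+ 2 * beta y)%:E.
have B0 : 0 <= B.
  by apply: integral_ge0 => y [Dy _]; rewrite lee_fin mulr_ge0 ?sqr_ge0 ?beta_ge0.
have := g2_ge Dz; rewrite -/B -/(tail z) => G2.
have st : tail z <= sqrte (B + tail z ^+ 2).
  rewrite -[leLHS](gee0_abs (tail_ge0 z)) -sqrte_sqr lee_sqrt ?leeDr//.
  by rewrite adde_ge0// sqre_ge0.
have s20 : (0 < Num.sqrt 2 :> R)%R by rewrite sqrtr_gt0.
have [a00|aN0] := eqVneq (alpha z) 0%R.
  (* Where alpha = 0 < beta the ratio is +oo, so the finite g2 forces a null tail. *)
  move: G2; rewrite a00 -!EFin_expe expr0n /= [(0%R%:E)^-1]/inve eqxx.
  rewrite gt0_muley ?lte_fin ?exprn_gt0// [+oo - 1]/= [sqrte +oo]/= => G2.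
  have : tail z = 0.
    apply/eqP; rewrite eq_le tail_ge0 andbT; apply: le_trans st _.
    rewrite leNgt; apply/negP => sp; move: G2.
    by rewrite gt0_muley ?leye_eq// mule_gt0// lte_fin.
  by move=> ->; rewrite mule0 lee_fin mulr_ge0.
have ap : (0 < alpha z)%R by rewrite lt_def aN0.
pose r := (beta z ^+ 2 / alpha z ^+ 2 - 1)%R.
have e : (beta z)%:E ^+ 2 / (alpha z)%:E ^+ 2 - 1 = r%:E.
  by rewrite -!EFin_expe inver expf_eq0 /= (negbTE aN0) -EFinM -EFinB.
move: G2; rewrite e [sqrte _]/= => G2.
have G2' : (Num.sqrt 2 * Num.sqrt r)%:E * tail z <= (g2 z)%:E.
  apply: le_trans G2; rewrite [leRHS]muleAC -EFinM lee_wpmul2l//.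
apply: (@le_trans _ _ ((beta z)%:E * ((Num.sqrt 2 * Num.sqrt r)%:E * tail z))).
  by rewrite muleA -EFinM lee_wpmul2r// lee_fin; exact: sqrt_ratio_ge.
by rewrite (mulrC (g2 z)) [leRHS]EFinM lee_wpmul2l.
Qed.

Variables (lambda : Z -> Omega -> R) (N : R.-ker Omega ~> Z).
Hypothesis mlambda : measurable_fun (D `*` [set: Omega])
  (fun p : Z * Omega => lambda p.1 p.2).
Hypothesis lambda_ge0 : forall z w, D z -> (0 <= lambda z w)%R.
Hypothesis coxN : conditionally_poisson P mu D lambda N.
Hypothesis lambda_bounds : {ae mu \x P, forall p : Z * Omega, D p.1 ->
  (alpha p.1 <= lambda p.1 p.2 <= beta p.1)%R}.

Let good : set Omega := [set w | {ae mu, forall z, D z ->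
  (alpha z <= lambda z w <= beta z)%R}].

Let ae_good : {ae P, forall w, good w}.
Proof. exact: (ae_ysection lambda_bounds). Qed.

Let mbeta : measurable_fun D beta.
Proof. by apply/measurable_EFinP; exact: measurable_int beta_L1. Qed.

Let mg1 : measurable_fun D g1. Proof. by case: g1_L2. Qed.
Let mg2 : measurable_fun D g2. Proof. by case: g2_L2. Qed.

Let mlam w : measurable_fun D (lambda^~ w).
Proof. exact: (@measurable_lambda1 _ _ _ _ _ D mD lambda mlambda D w). Qed.

Let good_fin w : good w -> \int[mu]_(z in D) (lambda z w)%:E < +oo.
Proof.
move=> gw; apply: (@le_lt_trans _ _ (\int[mu]_(z in D) (beta z)%:E)).
  apply: (ae_ge0_le_integral mD).
  - by move=> z Dz; rewrite lee_fin lambda_ge0.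
  - exact/measurable_EFinP.
  - by move=> z Dz; rewrite lee_fin beta_ge0.
  - exact/measurable_EFinP.
  - by apply: filterS gw => z h Dz; rewrite lee_fin; case/andP: (h Dz).
have := integrable_fin_num mD beta_L1.
by rewrite ge0_fin_numE//; apply: integral_ge0 => z Dz; rewrite lee_fin beta_ge0.
Qed.

Let g12_integrable : mu.-integrable D (fun z => (g1 z * g2 z * beta z)%:E).
Proof.
have [_ i1] := g1_L2; have [_ i2] := g2_L2.
apply: (le_integrable mD _ _ (integrableD mD i1 i2)).
  by apply/measurable_EFinP; do 2 apply: measurable_funM => //.
move=> z Dz; have b0 := beta_ge0 Dz; have h1 := g1_ge0 Dz; have h2 := g2_ge0 Dz.
change ((`|g1 z * g2 z * beta z|%R)%:E <= (`|g1 z ^+ 2 * beta z + g2 z ^+ 2 * beta z|%R)%:E).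
rewrite lee_fin !ger0_norm ?addr_ge0 ?mulr_ge0 ?sqr_ge0//.
rewrite -mulrDl ler_wpM2r//; have := sqr_ge0 (g1 z - g2 z).
by rewrite sqrrB; have := mulr_ge0 h1 h2; rewrite -mulr_natr; lra.
Qed.

Let K := fine (\int[mu]_(z in D) (g1 z * g2 z * beta z)%:E).

Let KE : \int[mu]_(z in D) (g1 z * g2 z * beta z)%:E = K%:E.
Proof. by rewrite /K fineK//; exact: (integrable_fin_num mD g12_integrable). Qed.

Let K_ge0 : (0 <= K)%R.
Proof.
rewrite fine_ge0// integral_ge0// => z Dz.
by rewrite lee_fin !mulr_ge0// ?g1_ge0 ?g2_ge0 ?beta_ge0.
Qed.

(** By [sqr_integral_le_ordered] the square of this integral is at most twice an
    integral of |g| |lambda - lambda'| times a tail. There |lambda - lambda'| is at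
    most beta - alpha and the tail at most that of g beta, so [g2_tail] applies. *)
Let good_osc w w' : good w -> good w' ->
  \int[mu]_(z in D) (`|g z| * `|lambda z w - lambda z w'|)%:E <= (Num.sqrt K)%:E.
Proof.
move=> gw gw'; pose psi z := (`|g z| * `|lambda z w - lambda z w'|)%R.
have mpsi : measurable_fun D psi.
  apply: measurable_funM; first exact: measurableT_comp.
  by apply: measurableT_comp => //; apply: measurable_funB; exact: mlam.
have psi0 z : D z -> (0 <= psi z)%R by move=> _; rewrite mulr_ge0.
have dif : {ae mu, forall z, D z -> (alpha z <= beta z)%R /\
    (`|lambda z w - lambda z w'| <= beta z - alpha z)%R}.
  apply: filterS2 gw gw' => z h h' Dz; have := h Dz; have := h' Dz.
  move=> /andP[a1 b1] /andP[a2 b2]; split; first by lra.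
  by rewrite ler_norml; apply/andP; split; lra.
have psi_le : {ae mu, forall z, D z -> (psi z <= `|g z| * beta z)%R}.
  apply: filterS dif => z h Dz; have [_ l] := h Dz.
  by rewrite ler_wpM2l// (le_trans l)// lerBlDr lerDl alpha_ge0.
have mlater z : measurable (later z).
  by apply: measurableI => //; exact: measurable_set_le.
pose J z := \int[mu]_(y in later z) (psi y)%:E.
have J0 z : 0 <= J z by apply: integral_ge0 => y [Dy _]; rewrite lee_fin psi0.
have Jtail z : J z <= tail z.
  apply: (ae_ge0_le_integral (mlater z)).
  - by move=> y [Dy _]; rewrite lee_fin psi0.
  - by apply/measurable_EFinP; apply: measurable_funS mpsi => // y [].
  - by move=> y [Dy _]; rewrite lee_fin mulr_ge0 ?beta_ge0.
  - apply/measurable_EFinP; apply: (@measurable_funS _ _ _ _ D) => //; first by move=> y [].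
    by apply: measurable_funM => //; exact: measurableT_comp.
  - by apply: filterS psi_le => y h [Dy _]; rewrite lee_fin h.
have mJ : measurable_fun D J by exact: (@measurable_tail_integral _ _ _ mu D mD tau psi mtau mpsi psi0).
have sq := @sqr_integral_le_ordered _ _ _ mu D mD tau psi mtau mpsi psi0.
have X0 : 0 <= \int[mu]_(z in D) (psi z)%:E.
  by apply: integral_ge0 => z Dz; rewrite lee_fin psi0.
have s0 : 0 <= (Num.sqrt K)%:E by rewrite lee_fin sqrtr_ge0.
rewrite -lee_sqr//.
apply: le_trans sq _; rewrite -EFin_expe sqr_sqrtr// -KE.
have mpJ : measurable_fun D (fun z => (psi z)%:E * J z).
  by apply: emeasurable_funM => //; exact/measurable_EFinP.
have pJ0 z : D z -> 0 <= (psi z)%:E * J z.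
  by move=> Dz; rewrite mule_ge0// lee_fin psi0.
rewrite -ge0_integralZl//.
apply: (ae_ge0_le_integral mD).
- by move=> z Dz; rewrite mule_ge0// pJ0.
- apply: emeasurable_funM; first exact: measurable_cst.
  by apply: emeasurable_funM => //; exact/measurable_EFinP.
- by move=> z Dz; rewrite lee_fin !mulr_ge0// ?g1_ge0 ?g2_ge0 ?beta_ge0.
- by apply/measurable_EFinP; do 2 apply: measurable_funM => //.
- apply: filterS dif => z h Dz; have [ab l] := h Dz.
  have b0 := beta_ge0 Dz; have h2 := g2_ge0 Dz.
  apply: (@le_trans _ _ (`|g z|%R%:E * ((2 * (beta z - alpha z))%:E * tail z))).
    rewrite [leRHS]muleA -[in leRHS]EFinM [leLHS]muleA -[in leLHS]EFinM.
    have p2 : (0 <= 2 * psi z)%R by rewrite mulr_ge0// psi0.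
    apply: (@le_trans _ _ ((2 * psi z)%R%:E * tail z)).
      by apply: lee_wpmul2l; [rewrite lee_fin|exact: Jtail].
    by apply: lee_wpmul2r => //; rewrite lee_fin /psi mulrCA !ler_wpM2l.
  apply: (@le_trans _ _ (`|g z|%R%:E * (g2 z * beta z)%:E)).
    by rewrite lee_wpmul2l// g2_tail.
  by rewrite -EFinM -mulrA lee_fin ler_wpM2r ?mulr_ge0// g1_ge.
Qed.

Variable G : Omega -> R.
Hypothesis mG : measurable_fun setT G.
Hypothesis GE : {ae P, forall w, (G w)%:E = \int[N w]_(z in D) (g z)%:E}.

Definition Lambda (th : R) : \bar R :=
  \int[mu]_(z in D) (phi (th * (g1 z + g2 z)) * beta z)%:E.

Lemma Lambda_ge0 th : 0 <= Lambda th.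
Proof.
by apply: integral_ge0 => z Dz; rewrite lee_fin mulr_ge0 ?phi_ge0 ?beta_ge0.
Qed.

(** [laplace_cox] gives the exponent S + th^2 K, with S the integral of
    phi (th g1) beta and K that of g1 g2 beta. This is at most Lambda th, by
    [phi_add] at x = th g1 and y = th g2. *)
Theorem laplace_transform_le (th : R) (f : R -> R) (C : R) : (0 <= th)%R ->
  Lambda th < +oo -> measurable_fun [set: R] f -> (forall x, (0 <= f x <= C)%R) ->
  lipschitz_with 1 f ->
  \int[P]_w (expR (th * f (G w)))%:E <=
  (expR (th * fine (\int[P]_w (f (G w))%:E) + fine (Lambda th)))%:E.
Proof.
move=> th0 Loo mf fC fL.
pose S := \int[mu]_(z in D) (phi (th * g1 z) * beta z)%:E.
have S0 : 0 <= S.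
  by apply: integral_ge0 => z Dz; rewrite lee_fin mulr_ge0 ?phi_ge0 ?beta_ge0.
have mS : measurable_fun D (fun z => (phi (th * g1 z) * beta z)%:E).
  apply/measurable_EFinP; apply: measurable_funM => //.
  apply: (measurableT_comp measurable_phi); apply: measurable_funM => //; exact: measurable_cst.
have m12 : measurable_fun D (fun z => (g1 z * g2 z * beta z)%:E).
  by apply/measurable_EFinP; do 2 apply: measurable_funM => //.
have SL : S + (th ^+ 2 * K)%:E <= Lambda th.
  rewrite EFinM -KE -ge0_integralZl//; last 2 first.
  - by move=> z Dz; rewrite lee_fin !mulr_ge0// ?g1_ge0 ?g2_ge0 ?beta_ge0.
  - by rewrite lee_fin sqr_ge0.
  rewrite -ge0_integralD//; last 3 first.
  - by move=> z Dz; rewrite lee_fin mulr_ge0 ?phi_ge0 ?beta_ge0.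
  - by move=> z Dz; rewrite -EFinM lee_fin !mulr_ge0// ?sqr_ge0 ?g1_ge0 ?g2_ge0 ?beta_ge0.
  - by apply: emeasurable_funM => //; exact: measurable_cst.
  apply: ge0_le_integral => //.
  - move=> z Dz; rewrite -EFinM -EFinD lee_fin.
    by rewrite addr_ge0// !mulr_ge0// ?phi_ge0 ?sqr_ge0 ?g1_ge0 ?g2_ge0 ?beta_ge0.
  - by apply: emeasurable_funD => //; apply: emeasurable_funM => //; exact: measurable_cst.
  - apply/measurable_EFinP; apply: measurable_funM => //.
    apply: (measurableT_comp measurable_phi); apply: measurable_funM; first exact: measurable_cst.
    exact: measurable_funD.
  - move=> z Dz; rewrite -EFinM -EFinD lee_fin mulrDr.
    have -> : (phi (th * g1 z) * beta z + th ^+ 2 * (g1 z * g2 z * beta z) =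
      (phi (th * g1 z) + (th * g1 z) * (th * g2 z)) * beta z)%R by ring.
    by rewrite ler_wpM2r ?beta_ge0// phi_add// mulr_ge0 ?g1_ge0 ?g2_ge0.
have Sfin : S \is a fin_num.
  rewrite ge0_fin_numE//; apply: le_lt_trans Loo; apply: le_trans SL.
  by rewrite leeDl// lee_fin mulr_ge0 ?sqr_ge0.
have good_phi w : good w ->
    \int[mu]_(z in D) (phi (th * `|g z|) * lambda z w)%:E <= (fine S)%:E.
  move=> gw; rewrite fineK//; apply: (ae_ge0_le_integral mD).
  - by move=> z Dz; rewrite lee_fin mulr_ge0 ?phi_ge0 ?lambda_ge0.
  - apply/measurable_EFinP; apply: measurable_funM; last exact: mlam.
    apply: (measurableT_comp measurable_phi); apply: measurable_funM; first exact: measurable_cst.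
    exact: measurableT_comp.
  - by move=> z Dz; rewrite lee_fin mulr_ge0 ?phi_ge0 ?beta_ge0.
  - exact: mS.
  - apply: filterS gw => z h Dz; have /andP[_ lb] := h Dz.
    rewrite lee_fin ler_pM ?phi_ge0 ?lambda_ge0//.
    apply: phi_le; rewrite ger0_norm ?mulr_ge0// ler_wpM2l//; exact: g1_ge.
pose F x := (th * f x)%R.
have mF : measurable_fun [set: R] F by apply: measurable_funM => //; exact: measurable_cst.
have FC x : (0 <= F x <= th * C)%R.
  by have /andP[f0 f1] := fC x; rewrite /F mulr_ge0// ler_wpM2l.
have FL : lipschitz_with th F.
  move=> x y; rewrite /F -mulrBr normrM (ger0_norm th0) ler_wpM2l//.
  by have := fL x y; rewrite mul1r.
have := laplace_cox mD mlambda lambda_ge0 coxN mg mF FC th0 FL ae_good good_fin good_phi good_osc mG GE.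
move=> /le_trans; apply; rewrite lee_fin ler_expR.
have -> : \int[P]_w (F (G w))%:E = th%:E * \int[P]_w (f (G w))%:E.
  rewrite -ge0_integralZl//.
  - by apply/measurable_EFinP; exact: measurableT_comp.
  - by move=> w _; rewrite lee_fin; case/andP: (fC (G w)).
have ffin : \int[P]_w (f (G w))%:E \is a fin_num.
  apply: (integrable_fin_num measurableT); apply: (@bounded_integrable R _ _ _ _ (f \o G) C) => //.
  - by rewrite (le_lt_trans (probability_le1 _ _)) ?ltry.
  - exact: measurableT_comp.
  - by move=> w _; exact: fC.
rewrite fineM// lerD2l exprMn sqr_sqrtr//.
have Lfin : Lambda th \is a fin_num by rewrite ge0_fin_numE// Lambda_ge0.
by rewrite -lee_fin EFinD !fineK.
Qed.

End comparison.

(** * The conjugate function *)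

Section conjugate.
Context {R : realType}.
Implicit Types (k : R -> \bar R) (x v M : R).

Lemma monotone_conjugate_ge k x th : (0 <= th)%R ->
  th%:E * x%:E - k th <= monotone_conjugate k x%:E.
Proof. by move=> th0; apply: ereal_sup_ubound; exists th. Qed.

(** The explicit expression is the conjugate of v / M ^ 2 * phi (th * M), computed at
    its maximizer. For v = 0 the conjugate of k is infinite at every x > 0. *)
Lemma monotone_conjugate_bennett k v M x : (0 <= v)%R -> (0 < M)%R -> (0 <= x)%R ->
  (forall th, (0 <= th)%R -> k th <= (v / M ^+ 2 * phi (th * M))%:E) ->
  (x%:E + (M^-1)%:E * v%:E) / M%:E * lne (1 + x%:E / ((M^-1)%:E * v%:E)) - x%:E / M%:E
  <= monotone_conjugate k x%:E.
Proof.
move=> v0 M0 x0 kb.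
have MN0 : M != 0%R by rewrite gt_eqF.
have invM : (M%:E)^-1 = (M^-1)%:E by rewrite inver (negbTE MN0).
have [vE|vN0] := eqVneq v 0%R.
  have k0 th : (0 <= th)%R -> k th <= 0.
    by move=> th0; rewrite (le_trans (kb _ th0))// vE !mul0r.
  have thx th : (0 <= th)%R -> (th * x)%:E <= monotone_conjugate k x%:E.
    move=> th0; apply: le_trans (monotone_conjugate_ge k x th0).
    by rewrite EFinM leeDl// oppe_ge0 k0.
  rewrite vE mule0 adde0 invM.
  have [x00|xN0] := eqVneq x 0%R.
    by have := thx 0%R (lexx _); rewrite mul0r x00 !mul0e sube0.
  have xp : (0 < x)%R by rewrite lt_def xN0.
  suff -> : monotone_conjugate k x%:E = +oo by exact: leey.
  apply/eqyP => r r0.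
  have rx : (0 <= r / x)%R by rewrite divr_ge0// ltW.
  by have := thx _ rx; rewrite divfK.
have vp : (0 < v)%R by rewrite lt_def vN0.
pose th := (ln (1 + x / (M^-1 * v)) / M)%R.
have q0 : (0 <= x / (M^-1 * v))%R by rewrite divr_ge0// mulr_ge0// ltW// invr_gt0.
have th0 : (0 <= th)%R by rewrite divr_ge0 ?ln_ge0 ?lerDl// ltW.
apply: le_trans (monotone_conjugate_ge k x th0).
apply: (@le_trans _ _ ((th * x)%:E - (v / M ^+ 2 * phi (th * M))%:E)); last first.
  by rewrite EFinM leeB// kb.
have mvN0 : (M^-1 * v != 0)%R by rewrite mulf_neq0 ?invr_eq0.
have q1 : (0 < 1 + x / (M^-1 * v))%R by rewrite ltr_wpDr.
have invMv : ((M^-1 * v)%R%:E)^-1 = ((M^-1 * v)^-1)%R%:E by rewrite inver (negbTE mvN0).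
rewrite -EFinM invMv invM -!EFinM -!EFinD lne_EFin// -EFinM -EFinB lee_fin.
rewrite /phi {2}/th divfK// lnK// le_eqVlt; apply/orP; left; apply/eqP.
by rewrite /th; field; rewrite MN0 vN0.
Qed.

End conjugate.

Section dt_measure.
Context {R : realType} {d : measure_display} {T : measurableType d}.
Variable nu : {finite_measure set T -> \bar R}.

(** A name for the measure dt nu(dx), to carry its sigma-finite structure. *)
Definition time_measure : set (measurableTypeR R * T) -> \bar R :=
  lebesgue_measure \x nu.

HB.instance Definition _ := Measure.on time_measure.

HB.instance Definition _ := Measure_isSigmaFinite.Build _ _ _ time_measure
  (lebesgue_integral_fubini.product_measure_sigma_finite_subproof _ nu).

End dt_measure.


Lemma sqr_add_le (R : realType) (a b : R) :
  ((a + b) ^+ 2 <= 2 * (a ^+ 2 + b ^+ 2))%R.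
Proof.
rewrite -subr_ge0.
have -> : (2 * (a ^+ 2 + b ^+ 2) - (a + b) ^+ 2 = (a - b) ^+ 2)%R by ring.
exact: sqr_ge0.
Qed.

Section bennett.
Context d (T : measurableType d) (R : realType) (mu : {measure set T -> \bar R}).
Variables (D : set T) (mD : measurable D) (beta h : T -> R).
Hypotheses (mbeta : measurable_fun D beta) (mh : measurable_fun D h).
Hypothesis beta_ge0 : forall z, D z -> (0 <= beta z)%R.
Hypothesis h_ge0 : forall z, D z -> (0 <= h z)%R.

Lemma ae_weighted_Linfty (M : R) : weighted_Linfty_norm mu D beta h <= M%:E ->
  {ae mu, forall z, D z -> (0 < beta z)%R -> (h z <= M)%R}.
Proof.
rewrite /weighted_Linfty_norm unlock /=; case: ifPn => [_ /ess_supP hM|m0 _].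
  apply: filterS hM => z + Dz bz.
  rewrite /= patchE mem_set// lee_fin => /(le_trans _); apply.
  exact: ler_norm.
exists setT; split => //.
by apply/eqP; rewrite eq_le measure_ge0 andbT leNgt.
Qed.

(** Where h <= M, [phi_scale] with t = h / M gives
    phi (th h) <= (h / M)^2 phi (th M). *)
Lemma integral_phi_le (M v th : R) : (0 < M)%R -> (0 <= th)%R ->
  {ae mu, forall z, D z -> (0 < beta z)%R -> (h z <= M)%R} ->
  \int[mu]_(z in D) ((h z) ^+ 2 * beta z)%:E = v%:E ->
  \int[mu]_(z in D) (phi (th * h z) * beta z)%:E <= (v / M ^+ 2 * phi (th * M))%:E.
Proof.
move=> M0 th0 hM vE.
have c0 : (0 <= phi (th * M) / M ^+ 2)%R by rewrite divr_ge0 ?phi_ge0 ?sqr_ge0.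
have mh2 : measurable_fun D (fun z => ((h z) ^+ 2 * beta z)%:E).
  by apply/measurable_EFinP; apply: measurable_funM => //; exact: measurable_funX.
have h20 z : D z -> 0 <= ((h z) ^+ 2 * beta z)%:E.
  by move=> Dz; rewrite lee_fin mulr_ge0 ?sqr_ge0 ?beta_ge0.
have -> : (v / M ^+ 2 * phi (th * M))%:E =
    \int[mu]_(z in D) ((phi (th * M) / M ^+ 2)%:E * ((h z) ^+ 2 * beta z)%:E).
  rewrite ge0_integralZl// vE -EFinM; congr EFin; ring.
apply: (ae_ge0_le_integral mD).
- by move=> z Dz; rewrite lee_fin mulr_ge0 ?phi_ge0 ?beta_ge0.
- apply/measurable_EFinP; apply: measurable_funM => //.
  apply: (measurableT_comp measurable_phi); apply: measurable_funM => //; exact: measurable_cst.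
- by move=> z Dz; rewrite mule_ge0 ?h20.
- by apply: emeasurable_funM => //; exact: measurable_cst.
- apply: filterS hM => z h1 Dz; have b0 := beta_ge0 Dz.
  have [->|bN0] := eqVneq (beta z) 0%R; first by rewrite !mulr0 mule0.
  have hz := h1 Dz (ltac:(by rewrite lt_def bN0)).
  rewrite -EFinM lee_fin mulrA ler_wpM2r//.
  have -> : (th * h z = (h z / M) * (th * M))%R by field; rewrite gt_eqF.
  apply: le_trans (phi_scale _ _) _.
  + by rewrite ger0_norm ?divr_ge0 ?h_ge0 ?(ltW M0)// ler_pdivrMr// mul1r.
  + by rewrite mulr_ge0// ltW.
  + by rewrite expr_div_n mulrC mulrA mulrAC.
Qed.

End bennett.

Theorem corollary3p12 (R : realType) (E : completeMetricType R)
    (sepE : separable E)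
    (nu : {finite_measure set (borelType E) -> \bar R})
    (d : measure_display) (Omega : measurableType d)
    (P : probability Omega R) (T : R) (T_ge0 : (0 <= T)%R)
    (lambda : timeSpace R E -> Omega -> R)
    (N : R.-ker Omega ~> timeSpace R E)
    (coxN : cox_process P nu T lambda N)
    (alpha beta : timeSpace R E -> R)
    (alpha_ge0 : forall z, slab 0 T z -> (0 <= alpha z)%R)
    (beta_ge0 : forall z, slab 0 T z -> (0 <= beta z)%R)
    (lambda_bounds : {ae (lebesgue_measure \x nu) \x P,
       forall p : timeSpace R E * Omega, slab 0 T p.1 ->
         (alpha p.1 <= lambda p.1 p.2 <= beta p.1)%R})
    (beta_L1 : (lebesgue_measure \x nu).-integrable (slab 0 T) (EFin \o beta))
    (beta3_alpha2_L1 : (lebesgue_measure \x nu).-integrable (slab 0 T)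
       (fun z => (beta z)%:E ^+ 3 / (alpha z)%:E ^+ 2))
    (g : timeSpace R E -> R)
    (g_L2 : weighted_L2 (lebesgue_measure \x nu) (slab 0 T) beta g)
    (G : {RV P >-> R})
    (GE : {ae P, forall omega,
       (G omega)%:E = \int[N omega]_(z in slab 0 T) (g z)%:E})
    (g1 g2 : timeSpace R E -> R)
    (g1_L2 : weighted_L2 (lebesgue_measure \x nu) (slab 0 T) beta g1)
    (g1_ge : forall z, slab 0 T z -> (`|g z| <= g1 z)%R)
    (g2_L2 : weighted_L2 (lebesgue_measure \x nu) (slab 0 T) beta g2)
    (g2_ge : forall z : timeSpace R E, slab 0 T z ->
       (Num.sqrt 2)%:E *
       sqrte (\int[lebesgue_measure \x nu]_(y in slab z.1 T)
                ((g y) ^+ 2 * beta y)%:E +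
              (\int[lebesgue_measure \x nu]_(y in slab z.1 T)
                (`|g y| * beta y)%:E) ^+ 2) *
       sqrte ((beta z)%:E ^+ 2 / (alpha z)%:E ^+ 2 - 1) <= (g2 z)%:E) :
  let h := fun z => (g1 z + g2 z)%R in
  let Lambda := fun theta : R =>
    \int[lebesgue_measure \x nu]_(z in slab 0 T)
      ((expR (theta * h z) - theta * h z - 1) * beta z)%:E in
  let c := monotone_conjugate Lambda in
  let V := \int[lebesgue_measure \x nu]_(z in slab 0 T)
             ((h z) ^+ 2 * beta z)%:E in
  let dist := fun x y : R => `|x - y|%R in
  (forall sigma : probability R R,
     finite_first_moment dist sigma ->
     c (transport_cost dist sigma (distribution P G)) <=
     relative_entropy sigma (distribution P G)) /\
  (forall M : R, (0 < M)%R ->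
     weighted_Linfty_norm (lebesgue_measure \x nu) (slab 0 T) beta h <= M%:E ->
     forall x : R, (0 <= x)%R ->
       (x%:E + (M^-1)%:E * V) / M%:E * lne (1 + x%:E / ((M^-1)%:E * V))
         - x%:E / M%:E <= c x%:E).
Proof.
case: coxN => mlambda lambda_ge0 _ coxN'.
pose mu : {sigma_finite_measure set (timeSpace R E) -> \bar R} := time_measure nu.
pose D : set (timeSpace R E) := slab 0 T.
pose tau : timeSpace R E -> R := fst.
have mD : measurable D by apply: measurableX => //; exact: measurable_itv.
have mtau : measurable_fun setT tau by exact: measurable_fst.
have laterE z : D z -> slab z.1 T = D `&` [set y | (tau z <= tau y)%R].
  move=> [/= z1 _]; move: z1; rewrite in_itv/= => /andP[z0 zT].
  apply/seteqP; split => y; rewrite /D /slab /tau /= !in_itv/=.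
    by move=> [/andP[h1 h2] _]; rewrite h2 (le_trans z0 h1) h1.
  by move=> [[/andP[_ ->] _] ->].
have g2_ge' z : D z ->
  (Num.sqrt 2)%:E *
  sqrte (\int[mu]_(y in D `&` [set y | (tau z <= tau y)%R]) ((g y) ^+ 2 * beta y)%:E +
    (\int[mu]_(y in D `&` [set y | (tau z <= tau y)%R]) (`|g y| * beta y)%:E) ^+ 2) *
  sqrte ((beta z)%:E ^+ 2 / (alpha z)%:E ^+ 2 - 1) <= (g2 z)%:E.
  by move=> Dz; rewrite -laterE//; exact: g2_ge.
have [mg _] := g_L2; have [mg1 ig1] := g1_L2; have [mg2 ig2] := g2_L2.
have g10 := @g1_ge0 R _ _ D g g1 g1_ge.
have g20 := @g2_ge0 R _ _ mu D tau alpha beta g g2 g2_ge'.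
move=> h L c V dist; split => [sigma _|M M0 hM x x0].
  apply: ub_ereal_sup => _ [th /= th0 <-].
  have [Loo|] := ltP (L th) +oo; last by rewrite leye_eq => /eqP ->; rewrite addeNy leNye.
  have L0 : 0 <= L th by exact: (@Lambda_ge0 _ _ _ mu D beta g1 g2 beta_ge0 th).
  have Lfin : L th \is a fin_num by rewrite ge0_fin_numE.
  rewrite -(fineK Lfin); apply: transport_entropy_of_laplace => // f C mf fC fL.
  have f0 y : (0 <= f y)%R by case/andP: (fC y).
  rewrite !ge0_integral_distribution//.
  - exact: (@laplace_transform_le _ _ _ P _ _ mu D mD tau mtau alpha beta g g1 g2
      alpha_ge0 beta_ge0 beta_L1 mg g1_L2 g2_L2 g1_ge g2_ge' lambda N mlambda
      lambda_ge0 coxN' lambda_bounds G _ GE th f C).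
  - exact/measurable_EFinP.
  - by apply/measurable_EFinP; apply: measurableT_comp => //; apply: measurable_funM.
have mbeta : measurable_fun D beta.
  by apply/measurable_EFinP; exact: measurable_int beta_L1.
have mh : measurable_fun D h by exact: measurable_funD.
have h0 z : D z -> (0 <= h z)%R by move=> Dz; rewrite addr_ge0 ?g10 ?g20.
have V0 : 0 <= V.
  by apply: integral_ge0 => z Dz; rewrite lee_fin mulr_ge0 ?sqr_ge0 ?beta_ge0.
have Vfin : V \is a fin_num.
  apply: (integrable_fin_num mD).
  have i12 := integrableZl mD 2 (integrableD mD ig1 ig2).
  apply: (le_integrable mD _ _ i12).
    by apply/measurable_EFinP; apply: measurable_funM => //; exact: measurable_funX.
  move=> z Dz; have b0 := beta_ge0 z Dz.
  change ((`|h z ^+ 2 * beta z|%R)%:E <=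
    (`|2 * (g1 z ^+ 2 * beta z + g2 z ^+ 2 * beta z)|%R)%:E).
  rewrite lee_fin !ger0_norm ?mulr_ge0 ?addr_ge0 ?mulr_ge0 ?sqr_ge0 ?g10 ?g20//.
  rewrite -mulrDl mulrA ler_wpM2r// /h.
  exact: sqr_add_le.
have VE : V = (fine V)%:E by apply/esym/fineK.
have v0 : (0 <= fine V)%R by exact: fine_ge0.
have aeM := ae_weighted_Linfty hM.
rewrite VE; apply: (monotone_conjugate_bennett v0 M0 x0) => th th0.
exact: (@integral_phi_le _ _ _ mu D mD beta h mbeta mh beta_ge0 h0 M (fine V) th
  M0 th0 aeM VE).
Qed.
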